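(* Let $F$ be a real random variable with a density $f:\mathbb R\to[0,\infty)$, such that $E[F]=0$ and $E[F^2]=1$, and assume that $F$ admits a Stein factor $\tau_F$. Let $Z\sim\mathscr N(0,1)$ be independent of $F$ and set $F_t=\sqrt t\,F+\sqrt{1-t}\,Z$ for $t\in[0,1]$. Then $$D(F\|Z)=\frac12\int_0^1\frac{t}{1-t}\,E\Big[E\big[Z(1-\tau_F(F))\,\big|\,F_t\big]^2\Big]\,dt.$$
   Context: A Stein factor of $F$ is a mapping $\tau_F:\mathbb R\to\mathbb R$ with $\tau_F(F)\in L^1$ and $E[Fg(F)]=E[\tau_F(F)g'(F)]$ for every smooth test function $g:\mathbb R\to\mathbb R$ for which both expectations are well defined (in particular for $g$ continuously differentiable with compact support, and for $g(x)=x$). The relative entropy is $D(F\|Z)=\int_{\mathbb R}f(x)\log(f(x)/\phi_1(x))\,dx$, where $\phi_1(x)=(2\pi)^{-1/2}e^{-x^2/2}$, with the conventions $0\log0:=0$ and $\log$ in base $e$. *)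

(* Defs.v *)
From HB Require Import structures.
From mathcomp Require Import all_boot all_order all_algebra.
From mathcomp Require Import all_classical all_reals all_analysis.

Set Implicit Arguments.
Unset Strict Implicit.
Unset Printing Implicit Defensive.

Import Order.TTheory GRing.Theory Num.Theory.
Import numFieldNormedType.Exports.

Local Open Scope classical_set_scope.
Local Open Scope ring_scope.

Definition independent_RVs (d d1 d2 : measure_display) (T : measurableType d)
    (T1 : measurableType d1) (T2 : measurableType d2) (R : realType)
    (P : probability T R) (X : {RV P >-> T1}) (Y : {RV P >-> T2}) : Prop :=
  forall (A : set T1) (B : set T2), measurable A -> measurable B ->
    P (X @^-1` A `&` Y @^-1` B) = (P (X @^-1` A) * P (Y @^-1` B))%E.

Definition has_density (d : measure_display) (T : measurableType d)
    (R : realType) (P : probability T R) (X : {RV P >-> R}) (f : R -> R) :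
    Prop :=
  [/\ measurable_fun setT f,
      forall x, 0 <= f x &
      forall A : set R, measurable A ->
        distribution P X A = (\int[lebesgue_measure]_(x in A) (f x)%:E)%E].

Definition is_normal (d : measure_display) (T : measurableType d)
    (R : realType) (P : probability T R) (X : {RV P >-> R}) (m s : R) : Prop :=
  forall A : set R, measurable A -> distribution P X A = normal_prob m s A.

(* "Smooth" means continuously differentiable: the requirement is meant to
   cover every C^1 function with compact support. The two expectations being
   "well defined" means that both integrands are integrable. *)
Definition is_Stein_factor (d : measure_display) (T : measurableType d)
    (R : realType) (P : probability T R) (F : {RV P >-> R}) (tau : R -> R) :
    Prop :=
  [/\ measurable_fun setT tau,
      P.-integrable setT (fun w => (tau (F w))%:E) &
      forall g : R -> R,
        (forall x, derivable g x 1) -> continuous (g^`())%classic ->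
        P.-integrable setT (fun w => (F w * g (F w))%:E) ->
        P.-integrable setT
          (fun w => (tau (F w) * (g^`())%classic (F w))%:E) ->
        ('E_P[fun w => (F w * g (F w))%R] =
         'E_P[fun w => (tau (F w) * (g^`())%classic (F w))%R])%E].

(* D(F || Z) for F of density f and Z standard normal, as an extended real.
   Since ln 0 = 0 in the library, the integrand is 0 wherever f vanishes. *)
Definition relative_entropy_normal (R : realType) (f : R -> R) : \bar R :=
  (\int[lebesgue_measure]_x (f x * ln (f x / normal_pdf 0 1 x))%:E)%E.

(* G is a version of E[X | Y]. *)
Definition is_cond_expectation (d d' : measure_display) (T : measurableType d)
    (T' : measurableType d') (R : realType) (P : probability T R)
    (X : T -> R) (Y : T -> T') (G : T -> R) : Prop :=
  [/\ measurable_fun [set: g_sigma_algebra_preimageType Y] G,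
      P.-integrable setT (fun w => (G w)%:E) &
      forall A : set T, g_sigma_algebra_preimage Y A ->
        (\int[P]_(w in A) (G w)%:E = \int[P]_(w in A) (X w)%:E)%E].

(* Some version of E[X | Y] (two versions agree P-almost surely); a version
   exists whenever X is integrable and Y is measurable. *)
Definition cond_expectation (d d' : measure_display) (T : measurableType d)
    (T' : measurableType d') (R : realType) (P : probability T R)
    (X : T -> R) (Y : T -> T') : T -> R :=
  xget (fun=> 0) [set G | is_cond_expectation P X Y G].

Definition interpolation (T : Type) (R : realType) (F Z : T -> R) (t : R) :
    T -> R :=
  fun w => Num.sqrt t * F w + Num.sqrt (1 - t) * Z w.

(* Main.v *)
(* Write q_s for the density of G_s = F + sqrt s Z, so that F_t = sqrt t G_s
   with t = 1 / (1 + s). Stein's identity for y |-> gauss_s (x - y) gives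
   E[Z (1 - tau F) | G_s] = - sqrt s ((1 + s) (q_s' / q_s)(G_s) + G_s), so the
   integrand is (I(G_s) / t - 1) / t with I the Fisher information. By de
   Bruijn's identity (the heat equation and an integration by parts) this is
   twice the derivative in t of the relative entropy H(t) of F_t, and the claim
   reduces to H(0+) = 0 and H(1-) = D(F || Z). All endpoint bounds come from the
   tangent inequality r ln r >= r (1 + ln c) - c: with c Gaussian, or c = q_s
   averaged over F, it bounds H near 0; with c = q_s(x) averaged over f it gives
   H(t) <= D(F || Z) + o(1); and testing q_s against c = e^g times the Gaussian
   density, for g bounded, bounds D(F || Z) by the limit of H after letting s
   tend to 0, approximating a truncation of ln (f / phi) by continuous g, and
   applying Fatou's lemma. *)

Require Import Defs.
From HB Require Import structures.
From mathcomp Require Import all_boot all_order all_algebra.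
From mathcomp Require Import all_classical all_reals all_analysis.
From mathcomp Require Import measurable_realfun ring lra.

Set Implicit Arguments.
Unset Strict Implicit.
Unset Printing Implicit Defensive.

Import Order.TTheory GRing.Theory Num.Theory.
Import numFieldNormedType.Exports.

Local Open Scope classical_set_scope.
Local Open Scope ring_scope.

(** [f] is merely measurable and D(F || Z) may be infinite, so no continuity of the entropy at s = 0
    can be invoked: the two inequalities at that end are proved separately. For s > 0 everything is
    regular. A Gaussian of twice the largest time dominates the kernel and its derivatives, and
    Jensen's inequality bounds ln q_s below by a quadratic, so the second moment of [F] makes every
    integrand of the heat-flow computation integrable, locally uniformly in s. Smoothing is written
    as an expectation over the sample space, and the density of [F] enters only in the limit of
    small noise. There it matters: almost everywhere convergence of test functions then passes to
    expectations under the law of [F]. As F_t has variance one, its cross entropy with Z is the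
    constant (ln (2 pi) + 1) / 2, so its relative entropy is a plain entropy plus explicit terms. As
    the integrand in t is nonnegative, its integral is the limit of increments of H over compact
    subintervals, be it finite or not. *)

(** * Calculus and integration *)

(* The library's derivation rules, restated for explicit lambda-terms. *)
Section derivation_rules.
Context (R : realType).
Implicit Types (f g : R -> R) (x c df dg : R).

Lemma is_derive_fC c x : is_derive x (1 : R) (fun=> c) (0 : R).
Proof. exact: is_derive_cst. Qed.

Lemma is_derive_fN f x df :
  is_derive x 1 f df -> is_derive x 1 (fun y => - f y) (- df).
Proof. exact: is_deriveN. Qed.

Lemma is_derive_fD f g x df dg : is_derive x 1 f df -> is_derive x 1 g dg ->
  is_derive x 1 (fun y => f y + g y) (df + dg).
Proof. exact: is_deriveD. Qed.

Lemma is_derive_fB f g x df dg : is_derive x 1 f df -> is_derive x 1 g dg ->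
  is_derive x 1 (fun y => f y - g y) (df - dg).
Proof. exact: is_deriveB. Qed.

Lemma is_derive_fM f g x df dg : is_derive x 1 f df -> is_derive x 1 g dg ->
  is_derive x 1 (fun y => f y * g y) (df * g x + f x * dg).
Proof.
move=> Df Dg; apply: (is_derive_eq (is_deriveM Df Dg)).
by rewrite addrC mulrC.
Qed.

Lemma is_derive_fZ c f x df : is_derive x 1 f df ->
  is_derive x 1 (fun y => c * f y) (c * df).
Proof. exact: is_deriveZ. Qed.

Lemma is_derive_comp f g x df dg :
  is_derive x 1 g dg -> is_derive (g x) 1 f df ->
  is_derive x 1 (fun y => f (g y)) (df * dg).
Proof. by move=> Dg Df; exact: is_derive1_comp. Qed.

Lemma is_derive_fV f x df : f x != 0 -> is_derive x 1 f df ->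
  is_derive x 1 (fun y => (f y)^-1) (- (f x ^- 2) * df).
Proof. exact: is_deriveV. Qed.

Lemma is_derive_rev c x : is_derive x 1 (fun y => c - y) (- 1).
Proof.
by rewrite -[-1]add0r; apply: is_derive_fB.
Qed.

Lemma is_derive_continuous f x df : is_derive x 1 f df -> {for x, continuous f}.
Proof. by move=> [/derivable1_diffP/differentiable_continuous]. Qed.

Lemma continuous_fM f g x : {for x, continuous f} -> {for x, continuous g} ->
  {for x, continuous (fun y => f y * g y)}.
Proof. exact: continuousM. Qed.

Lemma continuous_fB f g x : {for x, continuous f} -> {for x, continuous g} ->
  {for x, continuous (fun y => f y - g y)}.
Proof. exact: continuousB. Qed.

Lemma continuous_fD f g x : {for x, continuous f} -> {for x, continuous g} ->
  {for x, continuous (fun y => f y + g y)}.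
Proof. exact: continuousD. Qed.

Lemma continuous_fV f x : f x != 0 -> {for x, continuous f} ->
  {for x, continuous (fun y => (f y)^-1)}.
Proof. exact: continuousV. Qed.

Lemma continuous_fX n x : {for x, continuous (fun y : R => y ^+ n)}.
Proof. exact: exprn_continuous. Qed.

Lemma continuous_fC c x : {for x, continuous (fun=> c : R)}.
Proof. exact: cst_continuous. Qed.

End derivation_rules.

Section real_integrability.
Context d (T : measurableType d) (R : realType).
Variable mu : {measure set T -> \bar R}.
Implicit Types (f g : T -> R) (c : R).

Lemma integrable_fZ c f : mu.-integrable setT (EFin \o f) ->
  mu.-integrable setT (fun x => (c * f x)%:E).
Proof.
by move=> fi; under eq_fun do rewrite EFinM; exact: integrableZl.
Qed.

Lemma integrable_fN f : mu.-integrable setT (EFin \o f) ->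
  mu.-integrable setT (fun x => (- f x)%:E).
Proof. by move=> fi; under eq_fun do rewrite EFinN; exact: integrableN. Qed.

Lemma integrable_fD f g : mu.-integrable setT (EFin \o f) ->
  mu.-integrable setT (EFin \o g) ->
  mu.-integrable setT (fun x => (f x + g x)%:E).
Proof.
by move=> fi gi; under eq_fun do rewrite EFinD; exact: integrableD.
Qed.

Lemma integrable_fB f g : mu.-integrable setT (EFin \o f) ->
  mu.-integrable setT (EFin \o g) ->
  mu.-integrable setT (fun x => (f x - g x)%:E).
Proof.
by move=> fi gi; under eq_fun do rewrite EFinB; exact: integrableB.
Qed.

Lemma le_integrable_f f g : measurable_fun setT f ->
  (forall x, `|f x| <= g x) -> mu.-integrable setT (EFin \o g) ->
  mu.-integrable setT (EFin \o f).
Proof.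
move=> mf fg gi; apply: le_integrable gi => //; first exact/measurable_EFinP.
by move=> x _; rewrite /= lee_fin (le_trans (fg x))// ler_norm.
Qed.

Lemma integrable_measurable f : mu.-integrable setT (EFin \o f) ->
  measurable_fun setT f.
Proof. by move=> fi; apply/measurable_EFinP; exact: measurable_int fi. Qed.

Lemma EFin_Rintegral f : mu.-integrable setT (EFin \o f) ->
  (\int[mu]_x f x)%:E = (\int[mu]_x (f x)%:E)%E.
Proof. by move=> fi; rewrite /Rintegral fineK//; exact: integrable_fin_num. Qed.

End real_integrability.

(** * Change of measure and change of variable *)

Section density.
Context d (T : measurableType d) (R : realType).
Variables (mu nu : {measure set T -> \bar R}) (p : T -> R).
Hypotheses (mp : measurable_fun setT p) (p_ge0 : forall x, 0 <= p x).
Hypothesis nuE : forall A, measurable A ->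
  nu A = (\int[mu]_(x in A) (p x)%:E)%E.
Local Open Scope ereal_scope.
Import HBNNSimple.

(** On the level sets of a simple function the identity is [nuE]; monotone convergence along simple
    approximations extends it. *)
Lemma ge0_integral_density (f : T -> \bar R) :
  measurable_fun setT f -> (forall x, 0 <= f x) ->
  \int[nu]_x f x = \int[mu]_x (f x * (p x)%:E).
Proof.
move=> mf f0; pose f_ := nnsfun_approx (@measurableT _ T) mf.
have mfp n : measurable_fun setT (fun x => (f_ n x * p x)%:E).
  by apply/measurable_EFinP/measurable_funM => //; exact/measurable_funP.
transitivity (limn (fun n => \int[nu]_x (f_ n x)%:E)).
  rewrite -monotone_convergence//.
  - apply: eq_integral => x _; apply/esym/cvg_lim => //.
    exact: cvg_nnsfun_approx.
  - by move=> n; exact/measurable_EFinP/measurable_funP.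
  - by move=> n y _; rewrite lee_fin.
  - by move=> y _ m n mn; rewrite lee_fin; exact/lefP/nd_nnsfun_approx.
transitivity (limn (fun n => \int[mu]_x (f_ n x * p x)%:E)); last first.
  rewrite -monotone_convergence//; last 2 first.
  - by move=> n y _; rewrite lee_fin mulr_ge0.
  - move=> y _ m n mn; rewrite lee_fin ler_wpM2r//.
    exact/lefP/nd_nnsfun_approx.
  apply: eq_integral => x _; apply/cvg_lim => //.
  under eq_fun do rewrite EFinM.
  by apply: cvgeZr => //; exact: cvg_nnsfun_approx.
congr (limn _); apply/funext => n.
have mk k : measurable (f_ n @^-1` [set k]) by exact: measurable_funPTI.
rewrite integralT_nnsfun sintegralE.
transitivity (\sum_(k \in range (f_ n))
    \int[mu]_x (k * \1_(f_ n @^-1` [set k]) x * p x)%:E).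
  apply: eq_fsbigr => k /[!inE] -[y _ fy].
  rewrite nuE// integral_mkcond -ge0_integralZl//=.
  - apply: eq_integral => x _; rewrite patchE indicE.
    by case: ifP => _; rewrite ?mulr1 ?mulr0 ?mul0r ?mule0.
  - apply/(measurable_restrictT _ _).1 => //.
    exact/measurable_EFinP/measurable_funTS.
  - by move=> x _; apply: erestrict_ge0 => z _; rewrite lee_fin.
  - by rewrite lee_fin -fy.
rewrite -ge0_integral_fsum//; last 2 first.
- by move=> k; apply/measurable_EFinP; do 2!apply: measurable_funM => //.
- move=> k x _; rewrite EFinM mule_ge0 ?lee_fin//.
  exact: nnfun_muleindic_ge0.
apply: eq_integral => x _; rewrite [in RHS]fimfunE.
rewrite fsumEFin//.
by congr EFin; rewrite mulr_fsuml.
Qed.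

Lemma integral_density (f : T -> R) : measurable_fun setT f ->
  \int[nu]_x (f x)%:E = \int[mu]_x (f x * p x)%:E.
Proof.
move=> mf; have mEf : measurable_fun setT (EFin \o f) by exact/measurable_EFinP.
rewrite integralE [RHS]integralE.
rewrite !ge0_integral_density//; [|exact: measurable_funeneg|
  exact: measurable_funepos].
congr (_ - _); apply: eq_integral => x _.
- by rewrite !funeposE -EFin_max -EFinM -EFin_max maxr_pMl// mul0r.
- by rewrite !funenegE -!EFinN -!EFin_max -EFinM maxr_pMl// mul0r mulNr.
Qed.

End density.

Section affine.
Context (R : realType) (a b : R).
Hypothesis b_gt0 : 0 < b.
Local Notation leb := (@lebesgue_measure R).

Let phi (z : measurableTypeR R) : measurableTypeR R := a + b * z.

Let mphi : measurable_fun setT phi.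
Proof. by apply: measurable_funD => //; exact: measurable_funM. Qed.

Local Open Scope ereal_scope.

(** The right-hand side is [b] times a pushforward of Lebesgue measure, identified by its values on
    half-open intervals. *)
Lemma lebesgue_measure_affine (A : set R) : measurable A ->
  leb A = b%:E * leb (phi @^-1` A).
Proof.
have b0 : (0 <= b)%R by exact: ltW.
pose m : {measure set (measurableTypeR R) -> \bar R} :=
  mscale (NngNum b0) (pushforward leb phi).
move=> mA; rewrite (@lebesgue_measure_unique R (m mphi)) => //.
move=> _ [[u v]] _ <-; rewrite /m/= /mscale/= /pushforward.
have -> : phi @^-1` `]u, v]%classic =
    `]((u - a) / b)%R, ((v - a) / b)%R]%classic.
  apply/seteqP; split => z /=; rewrite !in_itv/= /phi ltr_pdivrMr// ler_pdivlMr//;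
  by rewrite ltrBlDl lerBrDl mulrC.
rewrite !lebesgue_measure_itv/= !lte_fin ltr_pM2r ?invr_gt0// ltrD2r.
case: ifPn => _; last by rewrite mule0.
by rewrite -!EFinB -EFinM -mulrBl mulrC divfK ?gt_eqF//; congr (_%:E); ring.
Qed.

Lemma ge0_integral_affine (W : R -> \bar R) :
  measurable_fun setT W -> (forall x, 0 <= W x) ->
  \int[leb]_x W x = b%:E * \int[leb]_z W (a + b * z)%R.
Proof.
move=> mW W0; have b0 : (0 <= b)%R by exact: ltW.
have -> : \int[leb]_z W (a + b * z)%R = \int[pushforward leb phi]_x W x.
  by rewrite ge0_integral_pushforward.
rewrite -(@ge0_integral_mscale _ _ _ (pushforward leb phi) _ measurableT
  (NngNum b0))//.
apply: eq_measure_integral => A mA _ /=.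
by rewrite lebesgue_measure_affine// /mscale.
Qed.

Lemma integral_affine (W : R -> R) : measurable_fun setT W ->
  \int[leb]_x (W x)%:E = b%:E * \int[leb]_z (W (a + b * z)%R)%:E.
Proof.
move=> mW; have mEW : measurable_fun setT (EFin \o W) by exact/measurable_EFinP.
rewrite integralE.
rewrite (ge0_integral_affine (measurable_funepos mEW) (funepos_ge0 _)).
rewrite (ge0_integral_affine (measurable_funeneg mEW) (funeneg_ge0 _)).
rewrite [in RHS]integralE.
under [X in _ = _ * (X - _)]eq_integral do rewrite funeposE.
under [X in _ = _ * (_ - X)]eq_integral do rewrite funenegE.
under [X in _ * X - _ = _]eq_integral do rewrite funeposE.
under [X in _ - _ * X = _]eq_integral do rewrite funenegE.
have b0 : (0 < b%:E)%E by rewrite lte_fin.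
(* Either part may be infinite, so distributing [b] over the difference goes by cases. *)
move: (integral _ _ _) (integral _ _ _) => [x| |] [y| |];
  rewrite ?(gt0_muley b0) ?(gt0_muleNy b0)//=.
by apply: (congr1 EFin (_ : b * y + - (b * x) = b * (y - x))%R); ring.
Qed.

End affine.

Section convolution.
Context (R : realType).
Local Notation leb := (@lebesgue_measure R).

Lemma Rintegral_shift (k : R -> R) (y : R) : measurable_fun setT k ->
  \int[leb]_x k (x - y) = \int[leb]_x k x.
Proof.
move=> mk; congr fine.
rewrite [RHS](@integral_affine _ (- y) 1 ltr01 _ mk) mul1e.
by apply: eq_integral => x _; rewrite mul1r addrC.
Qed.

Lemma integrable_shift (k : R -> R) (y : R) :
  leb.-integrable setT (EFin \o k) ->
  leb.-integrable setT (fun x => (k (x - y))%:E).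
Proof.
move=> /integrableP[/measurable_EFinP mk ik]; apply/integrableP; split.
  by apply/measurable_EFinP/measurableT_comp => //; exact: measurable_funB.
move: ik; rewrite (@ge0_integral_affine _ (- y) 1 ltr01)//; last first.
  by do 2!apply: measurableT_comp => //.
by rewrite mul1e; under eq_integral do rewrite mul1r addrC.
Qed.

Context d (T : measurableType d) (nu : {sigma_finite_measure set T -> \bar R}).
Variables (X h : T -> R) (k : R -> R).
Hypotheses (mX : measurable_fun setT X) (ih : nu.-integrable setT (EFin \o h))
  (ik : leb.-integrable setT (EFin \o k)).

Let mh : measurable_fun setT h.
Proof. by apply/measurable_EFinP; exact: measurable_int ih. Qed.

Let mk : measurable_fun setT k.
Proof. by apply/measurable_EFinP; exact: measurable_int ik. Qed.

Let f (p : T * R) : \bar R := (h p.1 * k (p.2 - X p.1))%:E.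

Let mf : measurable_fun setT f.
Proof.
apply/measurable_EFinP/measurable_funM.
  by apply: measurableT_comp => //; exact: measurable_fst.
apply: measurableT_comp => //; apply: measurable_funB.
  exact: measurable_snd.
by apply: measurableT_comp => //; exact: measurable_fst.
Qed.

(** [h] and [X] live on an arbitrary space, so that the same statements serve a random variable
    ([nu] = P, [X] = F) and Lebesgue measure ([X] the identity). By translation invariance the inner
    integral of |f| is |h y| times the L1 norm of [k]. *)
Lemma integrable_conv_prod : (nu \x leb)%E.-integrable setT f.
Proof.
have H := integrable12ltyP nu leb mf; apply/H => {H}.
rewrite (_ : (fun _ => _) =
  fun y => (`|h y|%:E * (\int[leb]_x `|k x|)%:E)%E); last first.
  apply/funext => y; rewrite /f.
  under eq_integral => x _ do rewrite /= normrM EFinM.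
  rewrite ge0_integralZl//=.
  - congr (_ * _)%E; rewrite -(Rintegral_shift (X y)); last exact: measurableT_comp.
    rewrite /Rintegral fineK//; apply: integrable_fin_num => //.
    exact: integrable_norm (integrable_shift (X y) ik).
  - apply/measurable_EFinP; do 2!apply: measurableT_comp => //.
    exact: measurable_funB.
rewrite ge0_integralZr//=; last 2 first.
- by apply/measurable_EFinP; exact: measurableT_comp.
- by rewrite lee_fin Rintegral_ge0.
apply: lte_mul_pinfty => //; last exact: ltry.
- exact: integral_ge0.
- by apply: integrable_fin_num => //; exact: integrable_norm.
Qed.

Let iG : leb.-integrable setT (fun x => \int[nu]_y f (y, x))%E.
Proof.
apply/integrableP; split; first exact: measurable_fubini_G integrable_conv_prod.
have H := integrable21ltyP nu leb mf.
apply: le_lt_trans (H.1 integrable_conv_prod).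
apply: ge0_le_integral => //.
- apply: measurableT_comp => //.
  exact: measurable_fubini_G integrable_conv_prod.
- apply: (measurable_fun_fubini_tonelli_G (abse \o f)) => //=.
  exact: measurableT_comp.
- by move=> x _; apply: le_abse_integral => //; exact: measurableT_comp.
Qed.

Lemma integrable_conv :
  leb.-integrable setT (fun x => (\int[nu]_y (h y * k (x - X y)))%:E).
Proof.
pose g x := (\int[nu]_y f (y, x))%E.
have -> : (fun x => (\int[nu]_y (h y * k (x - X y)))%:E) = EFin \o (fine \o g).
  by [].
apply: (le_integrable measurableT _ _ iG).
  apply/measurable_EFinP; apply: measurableT_comp => //.
  exact: measurable_int iG.
(* Where the extended inner integral is infinite, its real version is 0. *)
by move=> x _; rewrite /= -/(g x); case: (g x) => [r||] /=;
  rewrite ?normr0 ?leey.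
Qed.

Lemma Rintegral_conv :
  \int[leb]_x \int[nu]_y (h y * k (x - X y)) =
  (\int[nu]_y h y) * (\int[leb]_x k x).
Proof.
transitivity (fine (\int[leb]_x \int[nu]_y f (y, x))%E).
  congr fine; apply: ae_eq_integral => //.
  - exact: measurable_int integrable_conv.
  - exact: measurable_int iG.
  have := integrable_ae measurableT iG; apply: filterS => x /= /(_ I) fx _.
  by rewrite /Rintegral fineK.
rewrite -(Fubini integrable_conv_prod) -RintegralZr//; congr fine.
apply: eq_integral => y _; rewrite -(Rintegral_shift (X y))//.
have is_ := integrable_shift (X y) ik.
rewrite EFinM /Rintegral fineK; last exact: integrable_fin_num.
rewrite -integralZl//; apply: eq_integral => x _ /=.
Qed.
End convolution.

Section ftc.
Context (R : realType).
Local Notation leb := (@lebesgue_measure R).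

Lemma continuous_FTC2_itvcc (F f : R -> R) (a b : R) : a < b ->
  {in `[a, b], continuous f} ->
  {in `[a, b], forall x : R, is_derive x 1 F (f x)} ->
  (\int[leb]_(x in `[a, b]) (f x)%:E = (F b - F a)%:E)%E.
Proof.
move=> ab cf dF; rewrite EFinB.
have dFx (x : R) : x \in `[a, b] -> derivable F x 1 by move=> /dF[].
have cF (x : R) : x \in `[a, b] -> {for x, continuous F}.
  by move=> /dFx /derivable1_diffP /differentiable_continuous.
apply: continuous_FTC2 => //.
- by apply: continuous_in_subspaceT => x /set_mem /cf.
- split.
  + by move=> x /subset_itv_oo_cc /dFx.
  + by apply: cvg_at_right_filter; apply: cF; rewrite in_itv/= lexx ltW.
  + by apply: cvg_at_left_filter; apply: cF; rewrite in_itv/= lexx ltW.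
- by move=> x /subset_itv_oo_cc /dF ?; rewrite derive1E derive_val.
Qed.

(* Averaging [g'] over unit intervals gives the increments [g (x + 1) - g x],
   whose integral vanishes by translation invariance. *)
Lemma Rintegral_derive_eq0 (g g' : R -> R) :
  (forall x : R, is_derive x 1 g (g' x)) -> continuous g' ->
  leb.-integrable setT (EFin \o g) -> leb.-integrable setT (EFin \o g') ->
  \int[leb]_x g' x = 0.
Proof.
move=> dg cg' ig ig'.
have mg : measurable_fun setT g by apply/measurable_EFinP; exact: measurable_int ig.
(* Averaging is convolution with this indicator; its mass is one, so the integral of [g'] is
   unchanged. *)
pose h : R -> R := \1_`[(-1)%R, 0%R].
have ih : leb.-integrable setT (EFin \o h) by exact: integrable_indic_itv.
have mid : measurable_fun setT (fun x : measurableTypeR R => x : R).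
  exact: measurable_id.
have := Rintegral_conv mid ih ig'.
rewrite (_ : (\int[leb]_y h y = 1)%R) ?mul1r; last first.
  rewrite /Rintegral integral_indic//= setIT lebesgue_measure_itv/=.
  by rewrite lte_fin ltrN10/= opprK add0r.
move=> <-.
rewrite (_ : (fun x => _) = (fun x => g (x - (-1)) - g x)); last first.
  apply/funext => x.
  transitivity (\int[leb]_(y in `[(-1)%R, 0%R]) g' (x - y)).
    rewrite [RHS]Rintegral_mkcond; apply: eq_Rintegral => y _.
    by rewrite patchE /h indicE; case: ifP => _; rewrite ?mul1r ?mul0r.
  rewrite /Rintegral (@continuous_FTC2_itvcc (fun y => - g (x - y))) ?ltrN10//=.
  - by rewrite subr0; ring.
  - move=> y _; apply: continuous_comp; last exact: cg'.
    by apply: continuousB => //; exact: cst_continuous.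
  - move=> y _.
    apply: (is_derive_eq
      (is_derive_fN (is_derive_comp (is_derive_rev x y) (dg (x - y))))).
    by rewrite mulrN1 opprK.
rewrite RintegralB//; last exact: integrable_shift.
by rewrite Rintegral_shift// subrr.
Qed.

End ftc.

(** * The heat kernel *)

Section gauss.
Context (R : realType).
Implicit Types (s u x a b : R).
Local Notation leb := (@lebesgue_measure R).

(** The log-density of N(0, s). Defining [gauss] as its exponential makes positivity and logarithms
    immediate, and the derivatives in [u] and [s] plain chain rules. *)
Definition lgauss s u : R := - (ln (2 * pi * s) / 2) - u ^+ 2 / (2 * s).

Definition gauss s u : R := expR (lgauss s u).

Definition gauss1 s u : R := - (u / s) * gauss s u.

Definition gauss2 s u : R := (u ^+ 2 / s ^+ 2 - s^-1) * gauss s u.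

Lemma gauss_gt0 s u : 0 < gauss s u. Proof. exact: expR_gt0. Qed.

Lemma gauss_ge0 s u : 0 <= gauss s u. Proof. exact: expR_ge0. Qed.

Lemma ln_gauss s u : ln (gauss s u) = lgauss s u. Proof. exact: expRK. Qed.

Lemma gauss_normal_pdf s u : 0 < s ->
  gauss s u = normal_pdf 0 (Num.sqrt s) u.
Proof.
move=> s0; rewrite normal_pdfE ?gt_eqF ?sqrtr_gt0// /normal_peak /normal_fun.
rewrite subr0 sqr_sqrtr ?ltW// /gauss /lgauss expRD; congr (_ * expR _).
- rewrite expRN; congr (_^-1).
  have t0 : 0 < 2 * pi * s by rewrite !mulr_gt0// pi_gt0.
  have -> : s * pi *+ 2 = 2 * pi * s by rewrite -mulr_natr; ring.
  rewrite -[in RHS](@lnK _ (2 * pi * s)) ?posrE//.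
  have -> : ln (2 * pi * s) = ln (2 * pi * s) / 2 *+ 2 by field.
  by rewrite mulr2n expRD -expr2 sqrtr_sqr ger0_norm ?expR_ge0//; congr expR; field.
- by rewrite mulNr mulr_natl.
Qed.

Lemma gauss0_ub s u : 0 < s -> gauss s u <= gauss s 0.
Proof.
move=> s0; rewrite ler_expR lerD2l lerN2 expr0n/= mul0r.
by rewrite divr_ge0 ?sqr_ge0 ?mulr_ge0 ?ltW.
Qed.

(** The Jacobian identity for x = y + sqrt s * z, which turns the law of [Z] into the kernel
    [gauss s]. Writing sqrt s as expR (ln s / 2) reduces it to an identity of exponents. *)
Lemma gauss_scale s u : 0 < s ->
  Num.sqrt s * gauss s (Num.sqrt s * u) = gauss 1 u.
Proof.
move=> s0; have -> : Num.sqrt s = expR (ln s / 2).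
  rewrite -[in LHS](@lnK _ s)//.
  have -> : ln s = ln s / 2 *+ 2 by field.
  rewrite mulr2n expRD -expr2 sqrtr_sqr ger0_norm ?expR_ge0//.
  by congr expR; field.
rewrite /gauss -expRD /lgauss exprMn -expRM_natl.
have -> : expR (2%:R * (ln s / 2)) = s by rewrite mulrC divfK// lnK.
congr expR; have p0 := pi_gt0 R.
rewrite (@lnM _ (2 * pi) s) ?posrE ?mulr_gt0// !mulr1.
by field; rewrite gt_eqF.
Qed.

Lemma is_derive_gauss s u : 0 < s -> is_derive u 1 (gauss s) (gauss1 s u).
Proof.
move=> s0; have D2 : is_derive u 1 (fun u => u * u) (1 * u + u * 1).
  exact: is_derive_fM.
rewrite [gauss s](_ : _ = fun u => expR (- (ln (2 * pi * s) / 2) -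
  (2 * s)^-1 * (u * u))); last first.
  by apply/funext => v; rewrite /gauss /lgauss expr2 [_ / (2 * s)]mulrC.
apply: (is_derive_eq (is_derive_comp (is_derive_fB (is_derive_fC _ _)
  (is_derive_fZ _ D2)) (is_derive_expR _))).
rewrite /gauss1 /gauss /lgauss expr2 [_ / (2 * s)]mulrC [RHS]mulrC.
by congr (_ * _); field; rewrite gt_eqF.
Qed.

Lemma is_derive_gauss1 s u : 0 < s -> is_derive u 1 (gauss1 s) (gauss2 s u).
Proof.
move=> s0; rewrite [gauss1 s](_ : _ = fun u => - s^-1 * (u * gauss s u)); last first.
  by apply/funext => v; rewrite /gauss1; ring.
apply: (is_derive_eq (is_derive_fZ _ (is_derive_fM (is_derive_id _ _)
  (is_derive_gauss _ s0)))).
by rewrite /gauss2 /gauss1; field; rewrite gt_eqF.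
Qed.

Lemma continuous_gauss s : 0 < s -> continuous (gauss s).
Proof. by move=> s0 u; exact: is_derive_continuous (is_derive_gauss u s0). Qed.

Lemma continuous_gauss1 s : 0 < s -> continuous (gauss1 s).
Proof. by move=> s0 u; exact: is_derive_continuous (is_derive_gauss1 u s0). Qed.

Lemma continuous_gauss2 s : 0 < s -> continuous (gauss2 s).
Proof.
move=> s0 u; apply: (@continuous_fM _ (fun v => v ^+ 2 / s ^+ 2 - s^-1)).
  apply: continuous_fB; last exact: continuous_fC.
  by apply: continuous_fM; [exact: continuous_fX|exact: continuous_fC].
exact: continuous_gauss.
Qed.

(** The heat equation for the kernel. *)
Lemma is_derive_gauss_time s u : 0 < s ->
  is_derive s 1 (gauss ^~ u) (2^-1 * gauss2 s u).
Proof.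
move=> s0; have ps : 0 < 2 * pi * s by rewrite !mulr_gt0 ?pi_gt0.
rewrite [gauss ^~ u](_ : _ = fun s => expR (- (2^-1 * ln (2 * pi * s)) -
  (u ^+ 2 / 2) * s^-1)); last first.
  by apply/funext => v; rewrite /gauss /lgauss invfM mulrA [_ / 2]mulrC.
have Ds := is_derive_fZ (2 * pi) (is_derive_id s (1 : R)).
apply: (is_derive_eq (is_derive_comp (is_derive_fB
  (is_derive_fN (is_derive_fZ _ (is_derive_comp Ds (is_derive1_ln ps))))
  (is_derive_fZ _ (is_derive_fV _ (is_derive_id s 1)))) (is_derive_expR _))).
  by rewrite gt_eqF.
rewrite /gauss2 [RHS]mulrA [LHS]mulrC; congr (_ * _).
  move: (pi : R) (gt_eqF (pi_gt0 R)) => p p0.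
  by field; rewrite (gt_eqF s0) p0.
rewrite /gauss /lgauss; congr (expR _).
by rewrite invfM mulrA [ln _ / 2]mulrC.
Qed.

Lemma continuous_gauss2_time s u : 0 < s -> {for s, continuous (gauss2 ^~ u)}.
Proof.
move=> s0; have s1 : s != 0 by rewrite gt_eqF.
apply: (@continuous_fM _ (fun v => u ^+ 2 / v ^+ 2 - v^-1)); last first.
  exact: is_derive_continuous (is_derive_gauss_time u s0).
apply: continuous_fB; last exact: inv_continuous.
apply: continuous_fM; first exact: continuous_fC.
by apply: continuous_fV; [rewrite expf_neq0|exact: continuous_fX].
Qed.

(* Since [v * expR (- v) <= 1], half of the exponent absorbs the quadratic
   factor. *)
Lemma gauss_envelope a b : 0 < a -> a <= b -> exists C, forall s u,
  a <= s <= b -> (1 + u ^+ 2) * gauss s u <= C * gauss (2 * b) u.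
Proof.
move=> a0 ab; have b0 : 0 < b by exact: lt_le_trans ab.
(* The first factor bounds (1 + u ^ 2) * expR (- v), with [v] as below; the second is the ratio of
   the peaks of gauss a and gauss (2 * b). *)
exists ((1 + 4 * b) * expR (ln (2 * pi * (2 * b)) / 2 - ln (2 * pi * a) / 2)).
move=> s u /andP[as_ sb]; have s0 : 0 < s by exact: lt_le_trans as_.
set v := u ^+ 2 / (4 * b).
have v0 : 0 <= v by rewrite divr_ge0 ?sqr_ge0// mulr_ge0// ltW.
have E : (1 + u ^+ 2) * expR (- v) <= 1 + 4 * b.
  have e0 := expR_gt0 (- v).
  have ev : (1 + v) * expR (- v) <= 1.
    rewrite -[leRHS](expRxMexpNx_1 v) ler_wpM2r ?expR_ge0//.
    exact: expR_ge1Dx.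
  have -> : u ^+ 2 = 4 * b * v by rewrite /v mulrC divfK// gt_eqF ?mulr_gt0.
  move: (expR (- v)) e0 ev => e e0 ev.
  have ve0 : 0 <= v * e by rewrite mulr_ge0// ltW.
  rewrite mulrDl mul1r -mulrA lerD//; first by lra.
  by rewrite ler_piMr ?mulr_ge0 ?ltW//; lra.
have G : gauss s u <= expR (- (ln (2 * pi * a) / 2)) * expR (- v) * expR (- v).
  rewrite -!expRD ler_expR /lgauss -addrA; apply: lerD.
    rewrite lerN2 ler_pM2r ?invr_gt0// ler_ln ?posrE ?mulr_gt0 ?pi_gt0//.
    by rewrite ler_pM2l// mulr_gt0 ?pi_gt0.
  have -> : - v - v = - (u ^+ 2 / (2 * b)) by rewrite /v; field; rewrite gt_eqF.
  rewrite lerN2 ler_wpM2l ?sqr_ge0// lef_pV2 ?posrE ?mulr_gt0//.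
  by rewrite ler_pM2l.
have -> : (1 + 4 * b) * expR (ln (2 * pi * (2 * b)) / 2 - ln (2 * pi * a) / 2) *
    gauss (2 * b) u =
    (1 + 4 * b) * (expR (- (ln (2 * pi * a) / 2)) * expR (- v)).
  rewrite -mulrA; congr (_ * _); rewrite -!expRD; congr expR.
  by rewrite /lgauss /v; field; rewrite gt_eqF.
apply: le_trans (ler_wpM2l _ G) _; first by rewrite addr_ge0 ?sqr_ge0.
rewrite [leRHS]mulrC; set A := expR (- (ln _ / 2)); set e := expR (- v).
have -> : (1 + u ^+ 2) * (A * e * e) = A * e * ((1 + u ^+ 2) * e) by ring.
by rewrite ler_wpM2l// mulr_ge0 ?expR_ge0.
Qed.

Lemma gauss1_envelope a b : 0 < a -> a <= b -> exists C, forall s u,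
  a <= s <= b -> `|gauss1 s u| <= C * gauss (2 * b) u.
Proof.
move=> a0 ab; have [C HC] := gauss_envelope a0 ab; exists (a^-1 * C) => s u asb.
rewrite -mulrA; apply: le_trans (ler_wpM2l _ (HC s u asb)); last first.
  by rewrite invr_ge0 ltW.
move: asb => /andP[as_ _]; have s0 : 0 < s by exact: lt_le_trans as_.
have [a0' s0'] := (ltW a0, ltW s0).
rewrite normrM normrN normrM (ger0_norm (gauss_ge0 _ _)) mulrA.
rewrite ler_wpM2r ?gauss_ge0// [`|s^-1|]ger0_norm ?invr_ge0// mulrC.
apply: ler_pM; rewrite ?invr_ge0//; first by rewrite lef_pV2.
(* This square gives |u| <= 1 + u ^ 2. *)
have := sqr_ge0 (`|u| - 1); rewrite sqrrB1 real_normK ?num_real// => H.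
have := normr_ge0 u; lra.
Qed.

Lemma gauss2_envelope a b : 0 < a -> a <= b -> exists C, forall s u,
  a <= s <= b -> `|gauss2 s u| <= C * gauss (2 * b) u.
Proof.
move=> a0 ab; have [C HC] := gauss_envelope a0 ab.
exists ((a^-2 + a^-1) * C) => s u asb.
rewrite -mulrA; apply: le_trans (ler_wpM2l _ (HC s u asb)); last first.
  by rewrite addr_ge0// invr_ge0 ?sqr_ge0// ltW.
move: asb => /andP[as_ _]; have s0 : 0 < s by exact: lt_le_trans as_.
have [a0' s0'] := (ltW a0, ltW s0).
rewrite normrM (ger0_norm (gauss_ge0 _ _)) mulrA ler_wpM2r ?gauss_ge0//.
rewrite (le_trans (ler_normB _ _))// mulrDl lerD//.
  rewrite normrM mulrC !ger0_norm ?invr_ge0 ?sqr_ge0//.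
  apply: ler_pM; rewrite ?invr_ge0 ?sqr_ge0 ?lerDr//.
  by rewrite lef_pV2 ?posrE ?exprn_gt0// lerXn2r ?nnegrE.
rewrite ger0_norm ?invr_ge0// -[leLHS]mulr1.
apply: ler_pM; rewrite ?invr_ge0//; first by rewrite lef_pV2.
by rewrite lerDl sqr_ge0.
Qed.

Lemma measurable_gauss s : 0 < s -> measurable_fun setT (gauss s).
Proof. by move=> s0; apply: continuous_measurable_fun; exact: continuous_gauss. Qed.

Lemma measurable_gauss1 s : 0 < s -> measurable_fun setT (gauss1 s).
Proof. by move=> s0; apply: continuous_measurable_fun; exact: continuous_gauss1. Qed.

Lemma measurable_gauss2 s : 0 < s -> measurable_fun setT (gauss2 s).
Proof. by move=> s0; apply: continuous_measurable_fun; exact: continuous_gauss2. Qed.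

Lemma integral_gauss s : 0 < s -> (\int[leb]_u (gauss s u)%:E = 1)%E.
Proof.
move=> s0; under eq_integral do rewrite gauss_normal_pdf//.
exact: integral_normal_pdf.
Qed.

Lemma integrable_gauss s : 0 < s -> leb.-integrable setT (EFin \o gauss s).
Proof.
move=> s0; apply/integrableP; split.
  by apply/measurable_EFinP; exact: measurable_gauss.
under eq_integral do rewrite /= ger0_norm ?gauss_ge0//.
by rewrite integral_gauss// ltry.
Qed.

Lemma integrable_gauss_bound (s C : R) (k : R -> R) : 0 < s ->
  measurable_fun setT k -> (forall u, `|k u| <= C * gauss s u) ->
  leb.-integrable setT (EFin \o k).
Proof.
move=> s0 mk kC; apply: (le_integrable measurableT) (integrableZl measurableT C
  (integrable_gauss s0)); first exact/measurable_EFinP.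
by move=> u _; rewrite /= lee_fin (le_trans (kC u))// ler_norm.
Qed.

Lemma integrable_sqr_gauss s : 0 < s ->
  leb.-integrable setT (fun u => (u ^+ 2 * gauss s u)%:E).
Proof.
move=> s0; have [C HC] := gauss_envelope s0 (lexx s).
apply: (@integrable_gauss_bound (2 * s) C (fun u => u ^+ 2 * gauss s u)).
- by rewrite mulr_gt0.
- by apply: measurable_funM; [exact: measurable_funX|exact: measurable_gauss].
- move=> u; apply: le_trans (HC s u _); last by rewrite lexx.
  rewrite ger0_norm; last first.
    by apply: mulr_ge0; [exact: sqr_ge0|exact: gauss_ge0].
  by rewrite ler_wpM2r ?gauss_ge0// lerDr.
Qed.

Lemma integrable_mul_gauss s : 0 < s ->
  leb.-integrable setT (fun u => (u * gauss s u)%:E).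
Proof.
move=> s0; have [C HC] := gauss1_envelope s0 (lexx s).
apply: (@integrable_gauss_bound (2 * s) (s * C) (fun u => u * gauss s u)).
- by rewrite mulr_gt0.
- by apply: measurable_funM => //; exact: measurable_gauss.
- move=> u; rewrite -mulrA -ler_pdivrMl//.
  apply: le_trans (HC s u _); last by rewrite lexx.
  rewrite /gauss1 !normrM normrN normrM.
  by rewrite [`|s^-1|]ger0_norm ?invr_ge0 ?(ltW s0)// mulrA [s^-1 * _]mulrC.
Qed.

Lemma Rintegral_gauss s : 0 < s -> \int[leb]_u gauss s u = 1.
Proof. by move=> s0; rewrite /Rintegral integral_gauss. Qed.

(** The derivative of u * gauss s u is (1 - u ^ 2 / s) * gauss s u, and its integral vanishes. *)
Lemma Rintegral_sqr_gauss s : 0 < s -> \int[leb]_u (u ^+ 2 * gauss s u) = s.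
Proof.
move=> s0.
have E u : 1 * gauss s u + u * gauss1 s u = gauss s u - s^-1 * (u ^+ 2 * gauss s u).
  by rewrite /gauss1; ring.
have ig := integrable_gauss s0; have i2 := integrable_sqr_gauss s0.
have i2' : leb.-integrable setT
    (EFin \o (fun u => s^-1 * (u ^+ 2 * gauss s u))).
  exact: integrable_fZ.
pose g' u : R := 1 * gauss s u + u * gauss1 s u.
have gE : g' = fun u => gauss s u - s^-1 * (u ^+ 2 * gauss s u).
  exact/funext.
have : \int[leb]_u g' u = 0.
  apply: (@Rintegral_derive_eq0 _ (fun u => u * gauss s u)).
  - move=> u.
    exact: is_derive_fM (is_derive_id _ _) (is_derive_gauss _ s0).
  - rewrite gE => u; apply: continuous_fB; first exact: continuous_gauss.
    apply: continuous_fM; first exact: continuous_fC.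
    by apply: continuous_fM; [exact: continuous_fX|exact: continuous_gauss].
  - exact: integrable_mul_gauss.
  - by rewrite gE; exact: integrable_fB.
rewrite gE RintegralB// RintegralZl// Rintegral_gauss// => /subr0_eq /esym.
by move=> /(congr1 ( *%R s)); rewrite mulrA mulfV ?gt_eqF// mul1r mulr1.
Qed.

End gauss.

(** * Differentiation and continuity under the integral sign *)

Section under_integral.
Context d (T : measurableType d) (R : realType).
Variable mu : {measure set T -> \bar R}.
Variables (f f' : R -> T -> R) (a b x : R) (G : T -> R).
Hypothesis abx : x \in `]a, b[.
Hypothesis fi : forall y, y \in `]a, b[ -> mu.-integrable setT (EFin \o f y).
Hypothesis Gi : mu.-integrable setT (EFin \o G).

Lemma is_derive_Rintegral :
  (forall (y : R) w, y \in `]a, b[ -> is_derive y 1 (f ^~ w) (f' y w)) ->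
  (forall y w, y \in `]a, b[ -> `|f' y w| <= G w) ->
  is_derive x 1 (fun y => \int[mu]_w f y w) (\int[mu]_w f' x w).
Proof.
move=> fd fG.
have G0 w : 0 <= G w by rewrite (le_trans _ (fG _ w abx)).
have f'E y w : y \in `]a, b[ -> partial1of2 f y w = f' y w.
  by move=> yab; have ? := fd _ w yab; rewrite partial1of2E derive_val.
have fd' y w : `]a, b[%classic y -> setT w -> derivable (f ^~ w) y 1.
  by move=> yab _; have [] := fd _ w yab.
have fG' y w : `]a, b[%classic y -> setT w -> `|partial1of2 f y w| <= G w.
  by move=> yab _; rewrite f'E// fG.
apply: DeriveDef.
  exact: (@derivable_under_integral _ _ _ mu f setT measurableT x a b).
rewrite -derive1E.
rewrite (@differentiation_under_integral _ _ _ mu f setT measurableT x a b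
  abx fi fd' G G0 Gi fG').
by apply: eq_Rintegral => w _; rewrite f'E.
Qed.

Lemma continuous_Rintegral :
  (forall y w, y \in `]a, b[ -> {for y, continuous (f ^~ w)}) ->
  (forall y w, y \in `]a, b[ -> `|f y w| <= G w) ->
  {for x, continuous (fun y => \int[mu]_w f y w)}.
Proof.
move=> fc fG.
apply: (@continuity_under_integral _ _ _ mu f setT measurableT a b fi _ G) => //.
- by apply/aeW => w _ y /[!inE] yab; exact: fc.
- by move=> y yab; apply/aeW => w _; exact: fG.
- by rewrite inE.
Qed.

End under_integral.

Lemma integrable_bounded_mul d (T : measurableType d) (R : realType)
    (mu : {measure set T -> \bar R}) (f g : T -> R) (M : R) :
  measurable_fun setT f ->
  (forall w, `|f w| <= M) -> mu.-integrable setT (EFin \o g) ->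
  mu.-integrable setT (fun w => (g w * f w)%:E).
Proof.
move=> mf fM gi; apply: (@le_integrable_f _ _ _ _ _ (fun w => M * `|g w|)).
- by apply: measurable_funM => //; exact: integrable_measurable gi.
- by move=> w; rewrite normrM mulrC ler_wpM2r.
- by apply: integrable_fZ; exact: integrable_norm.
Qed.

Section bounded_integrand.
Context d (T : measurableType d) (R : realType) (P : probability T R).

Lemma integrable_bounded (f : T -> R) (M : R) : measurable_fun setT f ->
  (forall w, `|f w| <= M) -> P.-integrable setT (EFin \o f).
Proof.
move=> mf fM; apply: (@le_integrable_f _ _ _ _ _ (cst M)) => //.
by apply: finite_measure_integrable_cst.
Qed.

Lemma Rintegral_cst_prob (c : R) : \int[P]_w c = c.
Proof. by rewrite Rintegral_cst//= probability_setT mulr1. Qed.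

End bounded_integrand.

(** * The density of a noised variable *)

Section gaussian_smoothing.
Context d (T : measurableType d) (R : realType) (P : probability T R).
Variable F : T -> R.
Hypothesis mF : measurable_fun setT F.
Implicit Types (s x a b : R).
Local Notation leb := (@lebesgue_measure R).

(** This is q_s, shown to be the density of F + sqrt s Z in [law_noised]. As an expectation over the
    sample space it lets every derivative fall on the kernel. *)
Definition smooth s x : R := \int[P]_w gauss s (x - F w).

Definition smooth1 s x : R := \int[P]_w gauss1 s (x - F w).

Definition smooth2 s x : R := \int[P]_w gauss2 s (x - F w).

Lemma measurable_rev (k : R -> R) x :
  measurable_fun setT k -> measurable_fun setT (fun w => k (x - F w)).
Proof.
by move=> mk; apply: measurableT_comp => //; exact: measurable_funB.
Qed.

Lemma integrable_rev (k : R -> R) (M x : R) : measurable_fun setT k ->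
  (forall u, `|k u| <= M) -> P.-integrable setT (fun w => (k (x - F w))%:E).
Proof.
move=> mk kM; apply: (@integrable_bounded _ _ _ _ (fun w => k (x - F w)) M) => //.
exact: measurable_rev.
Qed.

Lemma integrable_rev_mul (k : R -> R) (M x : R) (h : T -> R) :
  measurable_fun setT k -> (forall u, `|k u| <= M) ->
  P.-integrable setT (EFin \o h) ->
  P.-integrable setT (fun w => (h w * k (x - F w))%:E).
Proof.
move=> mk kM hi.
apply: (@integrable_bounded_mul _ _ _ P (fun w => k (x - F w)) h M) => //.
exact: measurable_rev.
Qed.

Lemma gauss_bounded s u : 0 < s -> `|gauss s u| <= gauss s 0.
Proof. by move=> s0; rewrite ger0_norm ?gauss_ge0// gauss0_ub. Qed.

Lemma gauss1_bounded s : 0 < s -> exists M, forall u, `|gauss1 s u| <= M.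
Proof.
move=> s0; have [C HC] := gauss1_envelope s0 (lexx s).
exists (`|C| * gauss (2 * s) 0) => u.
have ss : s <= s <= s by rewrite lexx.
rewrite (le_trans (HC s u ss))//.
rewrite (le_trans (ler_wpM2r (gauss_ge0 _ _) (ler_norm C)))//.
by rewrite ler_wpM2l// gauss0_ub// mulr_gt0.
Qed.

Lemma mul_gauss_bounded s : 0 < s ->
  exists M, forall u, `|u * gauss s u| <= M.
Proof.
move=> s0; have [M HM] := gauss1_bounded s0; exists (s * M) => u.
have -> : u * gauss s u = s * (- gauss1 s u).
  by rewrite /gauss1; field; rewrite gt_eqF.
by rewrite normrM normrN (gtr0_norm s0) ler_pM2l.
Qed.

Lemma sqr_gauss_bounded s : 0 < s ->
  exists M, forall u, `|u ^+ 2 * gauss s u| <= M.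
Proof.
move=> s0; have [C HC] := gauss_envelope s0 (lexx s).
exists (`|C| * gauss (2 * s) 0) => u.
have ss : s <= s <= s by rewrite lexx.
rewrite ger0_norm; last by apply: mulr_ge0; [exact: sqr_ge0|exact: gauss_ge0].
apply: (@le_trans _ _ ((1 + u ^+ 2) * gauss s u)).
  by rewrite ler_wpM2r ?gauss_ge0// lerDr.
rewrite (le_trans (HC s u ss))//.
rewrite (le_trans (ler_wpM2r (gauss_ge0 _ _) (ler_norm C)))//.
by rewrite ler_wpM2l// gauss0_ub// mulr_gt0.
Qed.

Lemma gauss2_bounded a b : 0 < a -> a <= b ->
  exists M, forall s u, a <= s <= b -> `|gauss2 s u| <= M.
Proof.
move=> a0 ab; have [C HC] := gauss2_envelope a0 ab.
exists (`|C| * gauss (2 * b) 0) => s u asb.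
rewrite (le_trans (HC s u asb))//.
rewrite (le_trans (ler_wpM2r (gauss_ge0 _ _) (ler_norm C)))//.
by rewrite ler_wpM2l// gauss0_ub// mulr_gt0// (lt_le_trans a0).
Qed.

Lemma integrable_gauss_rev s x : 0 < s ->
  P.-integrable setT (fun w => (gauss s (x - F w))%:E).
Proof.
move=> s0; apply: (@integrable_rev _ (gauss s 0)).
  exact: measurable_gauss.
by move=> u; exact: gauss_bounded.
Qed.

Lemma integrable_gauss1_rev s x : 0 < s ->
  P.-integrable setT (fun w => (gauss1 s (x - F w))%:E).
Proof.
move=> s0; have [M HM] := gauss1_bounded s0.
by apply: (@integrable_rev _ M) => //; exact: measurable_gauss1.
Qed.

Lemma integrable_sqr_gauss_rev s x : 0 < s ->
  P.-integrable setT (fun w => ((x - F w) ^+ 2 * gauss s (x - F w))%:E).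
Proof.
move=> s0; have [M HM] := sqr_gauss_bounded s0.
apply: (@integrable_rev (fun u => u ^+ 2 * gauss s u) M) => //.
by apply: measurable_funM; [exact: measurable_funX|exact: measurable_gauss].
Qed.

Lemma integrable_gauss2_rev s x : 0 < s ->
  P.-integrable setT (fun w => (gauss2 s (x - F w))%:E).
Proof.
move=> s0; have [M HM] := gauss2_bounded s0 (lexx s).
apply: (@integrable_rev _ M); first exact: measurable_gauss2.
by move=> u; apply: HM; rewrite lexx.
Qed.

Let is_derive_conv (k k1 : R -> R) (M x : R) :
  (forall u : R, is_derive u 1 k (k1 u)) -> (forall u, `|k1 u| <= M) ->
  (forall x, P.-integrable setT (fun w => (k (x - F w))%:E)) ->
  is_derive x 1 (fun x => \int[P]_w k (x - F w)) (\int[P]_w k1 (x - F w)).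
Proof.
move=> dk k1M ki.
apply: (@is_derive_Rintegral _ _ _ P (fun x w => k (x - F w))
  (fun x w => k1 (x - F w)) (x - 1) (x + 1) x (cst M)) => //.
- by rewrite in_itv/=; apply/andP; split; lra.
- by move=> y _; exact: ki.
- exact: finite_measure_integrable_cst.
- move=> y w _; apply: (is_derive_eq (is_derive_comp
    (is_derive_fB (is_derive_id y (1 : R)) (is_derive_fC (F w) y))
    (dk (y - F w)))).
  by rewrite subr0 mulr1.
Qed.

Lemma is_derive_smooth s x : 0 < s -> is_derive x 1 (smooth s) (smooth1 s x).
Proof.
move=> s0; have [M HM] := gauss1_bounded s0.
apply: (@is_derive_conv _ _ M) => //.
- by move=> u; exact: is_derive_gauss.
- by move=> y; exact: integrable_gauss_rev.
Qed.

Lemma is_derive_smooth1 s x : 0 < s -> is_derive x 1 (smooth1 s) (smooth2 s x).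
Proof.
move=> s0; have [M HM] := gauss2_bounded s0 (lexx s).
apply: (@is_derive_conv _ _ M) => //.
- by move=> u; exact: is_derive_gauss1.
- by move=> u; apply: HM; rewrite lexx.
- by move=> y; exact: integrable_gauss1_rev.
Qed.

(** A window of times around [s], bounded away from 0, on which the envelopes are uniform. *)
Lemma half_double s : 0 < s ->
  [/\ 0 < s / 2, s / 2 <= 2 * s & s \in `]s / 2, (2 * s)[].
Proof. by move=> s0; split; rewrite ?in_itv/=; last apply/andP; try split; lra. Qed.

Lemma is_derive_smooth_time s x : 0 < s ->
  is_derive s 1 (smooth ^~ x) (2^-1 * smooth2 s x).
Proof.
move=> s0; have [h0 h2 hs] := half_double s0.
have [M HM] := gauss2_bounded h0 h2.
have pos y : y \in `]s / 2, (2 * s)[ -> 0 < y.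
  by rewrite in_itv/= => /andP[hy _]; exact: lt_trans hy.
rewrite /smooth2 -RintegralZl//; last exact: integrable_gauss2_rev.
apply: (@is_derive_Rintegral _ _ _ P (fun s w => gauss s (x - F w))
  (fun s w => 2^-1 * gauss2 s (x - F w)) (s / 2) (2 * s) s (cst (2^-1 * M))) => //.
- by move=> y /pos y0; exact: integrable_gauss_rev.
- exact: finite_measure_integrable_cst.
- by move=> y w /pos y0; exact: is_derive_gauss_time.
- move=> y w yI; rewrite normrM ger0_norm// ler_pM2l//.
  by apply: HM; move: yI; rewrite in_itv/= => /andP[/ltW -> /ltW ->].
Qed.

Lemma continuous_smooth s : 0 < s -> continuous (smooth s).
Proof.
by move=> s0 x; exact: is_derive_continuous (is_derive_smooth x s0).
Qed.

Lemma continuous_smooth1 s : 0 < s -> continuous (smooth1 s).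
Proof.
by move=> s0 x; exact: is_derive_continuous (is_derive_smooth1 x s0).
Qed.

Lemma continuous_smooth2 s : 0 < s -> continuous (smooth2 s).
Proof.
move=> s0 x; have [M HM] := gauss2_bounded s0 (lexx s).
apply: (@continuous_Rintegral _ _ _ P (fun x w => gauss2 s (x - F w))
  (x - 1) (x + 1) x (cst M)) => //.
- by rewrite in_itv/=; apply/andP; split; lra.
- by move=> y _; exact: integrable_gauss2_rev.
- exact: finite_measure_integrable_cst.
- move=> y w _; apply: continuous_comp; last exact: continuous_gauss2.
  by apply: continuous_fB => //; exact: continuous_fC.
- by move=> y w _; apply: HM; rewrite lexx.
Qed.

Lemma continuous_smooth2_time s x : 0 < s -> {for s, continuous (smooth2 ^~ x)}.
Proof.
move=> s0; have [h0 h2 hs] := half_double s0.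
have [M HM] := gauss2_bounded h0 h2.
have pos y : y \in `]s / 2, (2 * s)[ -> 0 < y.
  by rewrite in_itv/= => /andP[hy _]; exact: lt_trans hy.
apply: (@continuous_Rintegral _ _ _ P (fun s w => gauss2 s (x - F w))
  (s / 2) (2 * s) s (cst M)) => //.
- by move=> y /pos y0; exact: integrable_gauss2_rev.
- exact: finite_measure_integrable_cst.
- by move=> y w /pos y0; exact: continuous_gauss2_time.
- move=> y w yI.
  by apply: HM; move: yI; rewrite in_itv/= => /andP[/ltW -> /ltW ->].
Qed.

End gaussian_smoothing.

Section smoothing_bounds.
Context d (T : measurableType d) (R : realType) (P : probability T R).
Variable F : T -> R.
Hypothesis mF : measurable_fun setT F.
Implicit Types (s x a b : R).
Local Notation leb := (@lebesgue_measure R).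
Local Notation smooth := (smooth P F).
Local Notation smooth1 := (smooth1 P F).
Local Notation smooth2 := (smooth2 P F).

Lemma smooth_ub s x : 0 < s -> smooth s x <= gauss s 0.
Proof.
move=> s0; rewrite -[leRHS](Rintegral_cst_prob P).
apply: le_Rintegral => //.
- exact: integrable_gauss_rev.
- exact: finite_measure_integrable_cst.
- by move=> w _; exact: gauss0_ub.
Qed.

Lemma integrable_smooth s : 0 < s -> leb.-integrable setT (EFin \o smooth s).
Proof.
move=> s0; have i1 : P.-integrable setT (EFin \o (cst 1 : T -> R)).
  exact: finite_measure_integrable_cst.
apply: eq_integrable (integrable_conv mF i1 (integrable_gauss s0)) => //.
by move=> x _; congr EFin; apply: eq_Rintegral => w _; rewrite mul1r.
Qed.

Lemma Rintegral_smooth s : 0 < s -> \int[leb]_x smooth s x = 1.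
Proof.
move=> s0; have i1 : P.-integrable setT (EFin \o (cst 1 : T -> R)).
  exact: finite_measure_integrable_cst.
have := Rintegral_conv mF i1 (integrable_gauss s0).
rewrite Rintegral_gauss// Rintegral_cst_prob mulr1 => <-.
by apply: eq_Rintegral => x _; apply: eq_Rintegral => w _; rewrite mul1r.
Qed.

Lemma smooth_envelope (k : R -> R) (C x s : R) : 0 < s ->
  measurable_fun setT k -> (forall u, `|k u| <= C * gauss s u) ->
  `|\int[P]_w k (x - F w)| <= C * smooth s x.
Proof.
move=> s0 mk kC.
have gi := integrable_gauss_rev P mF x s0.
have Cgi : P.-integrable setT (fun w => (C * gauss s (x - F w))%:E).
  exact: integrable_fZ.
have ki : P.-integrable setT (fun w => (k (x - F w))%:E).
  apply: (@le_integrable_f _ _ _ _ _ (fun w => C * gauss s (x - F w))) => //.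
  exact: measurable_rev.
apply: le_trans (le_normr_Rintegral measurableT ki) _.
rewrite /smooth -RintegralZl//; apply: le_Rintegral => //.
exact: integrable_norm.
Qed.

(** The majorant is again a smoothed density, at time 2 * b, hence integrable even against 1 + x ^ 2
    when [F] has a second moment. *)
Lemma smooth1_envelope a b : 0 < a -> a <= b -> exists C, forall s x,
  a <= s <= b -> `|smooth1 s x| <= C * smooth (2 * b) x.
Proof.
move=> a0 ab; have [C HC] := gauss1_envelope a0 ab; exists C => s x asb.
have s0 : 0 < s by move: asb => /andP[as_ _]; exact: lt_le_trans as_.
apply: smooth_envelope; first by rewrite mulr_gt0// (lt_le_trans a0).
  exact: measurable_gauss1.
by move=> u; exact: HC.
Qed.

Lemma smooth2_envelope a b : 0 < a -> a <= b -> exists C, forall s x,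
  a <= s <= b -> `|smooth2 s x| <= C * smooth (2 * b) x.
Proof.
move=> a0 ab; have [C HC] := gauss2_envelope a0 ab; exists C => s x asb.
have s0 : 0 < s by move: asb => /andP[as_ _]; exact: lt_le_trans as_.
apply: smooth_envelope; first by rewrite mulr_gt0// (lt_le_trans a0).
  exact: measurable_gauss2.
by move=> u; exact: HC.
Qed.

Hypothesis iF : P.-integrable setT (EFin \o F).
Hypothesis F1 : \int[P]_w F w = 0.
Hypothesis iF2 : P.-integrable setT (fun w => (F w ^+ 2)%:E).
Hypothesis F2 : \int[P]_w (F w ^+ 2) = 1.

(* Jensen's inequality for [expR], the exponent having mean
   [- ln (2 * pi * s) / 2 - (x ^+ 2 + 1) / (2 * s)]. *)
Lemma smooth_lb s x : 0 < s ->
  expR (- (ln (2 * pi * s) / 2) - (x ^+ 2 + 1) / (2 * s)) <= smooth s x.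
Proof.
move=> s0; set m := _ - _.
(* [V] is the deviation of lgauss s (x - F) from its mean [m]; it has mean 0, so integrating expR (m
   + V) >= expR m * (1 + V) gives the claim. *)
pose V w := (2 * s)^-1 * (2 * x * F w - F w ^+ 2 + 1).
have i1 : P.-integrable setT (EFin \o (cst 1 : T -> R)).
  exact: finite_measure_integrable_cst.
have i2 : P.-integrable setT (EFin \o (fun w => 2 * x * F w)).
  exact: integrable_fZ.
have i3 : P.-integrable setT (EFin \o (fun w => 2 * x * F w - F w ^+ 2)).
  exact: integrable_fB.
have i4 : P.-integrable setT (EFin \o (fun w => 2 * x * F w - F w ^+ 2 + 1)).
  exact: integrable_fD.
have iV : P.-integrable setT (EFin \o V) by exact: integrable_fZ.
have iV1 : P.-integrable setT (EFin \o (fun w => 1 + V w)).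
  exact: integrable_fD.
have -> : expR m = \int[P]_w (expR m * (1 + V w)).
  rewrite RintegralZl// RintegralD// Rintegral_cst_prob RintegralZl//.
  rewrite RintegralD// RintegralB// RintegralZl// F1 F2 Rintegral_cst_prob.
  by rewrite mulr0 sub0r addNr mulr0 addr0 mulr1.
apply: le_Rintegral => //.
- exact: integrable_fZ.
- exact: integrable_gauss_rev.
move=> w _; rewrite /= /gauss.
have -> : lgauss s (x - F w) = m + V w.
  by rewrite /lgauss /m /V; field; rewrite gt_eqF.
by rewrite (expRD m (V w)) ler_wpM2l ?expR_ge0// expR_ge1Dx.
Qed.

Lemma smooth_gt0 s x : 0 < s -> 0 < smooth s x.
Proof. by move=> s0; apply: lt_le_trans (smooth_lb x s0); exact: expR_gt0. Qed.

(** Above, ln q_s is bounded by a constant ([smooth_ub]); below, by a quadratic ([smooth_lb]). With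
    the second moment of q_s this makes all logarithmic integrands integrable. *)
Lemma ln_smooth_bound a b : 0 < a -> a <= b -> exists C, 0 <= C /\ forall s x,
  a <= s <= b -> `|ln (smooth s x)| <= C * (1 + x ^+ 2).
Proof.
move=> a0 ab; have b0 : 0 < b by exact: lt_le_trans ab.
pose L s : R := ln (2 * pi * s) / 2.
have Lh s t : 0 < s -> s <= t -> L s <= L t.
  move=> s0 st; have t0 : 0 < t by exact: lt_le_trans st.
  rewrite ler_pM2r// ler_ln ?posrE ?mulr_gt0 ?pi_gt0// ler_pM2l//.
  by rewrite mulr_gt0 ?pi_gt0.
exists (`|L a| + `|L b| + (2 * a)^-1); split.
  by rewrite addr_ge0// ?addr_ge0// invr_ge0 mulr_ge0 ?ltW.
move=> s x /andP[as_ sb]; have s0 : 0 < s by exact: lt_le_trans as_.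
have La := Lh _ _ a0 as_; have Lb := Lh _ _ s0 sb.
have q0 := smooth_gt0 x s0.
have lb := smooth_lb x s0; have ub := smooth_ub x s0.
have {}lb : - L s - (x ^+ 2 + 1) / (2 * s) <= ln (smooth s x).
  by rewrite -ler_expR lnK.
have {}ub : ln (smooth s x) <= - L s.
  rewrite -ler_expR lnK//; apply: le_trans ub _.
  by rewrite /gauss /lgauss expr0n/= mul0r subr0.
have inv : (x ^+ 2 + 1) / (2 * s) <= (x ^+ 2 + 1) / (2 * a).
  rewrite ler_wpM2l ?addr_ge0 ?sqr_ge0// lef_pV2 ?posrE ?mulr_gt0//.
  by rewrite ler_pM2l.
have x0 := sqr_ge0 x.
have i0 : 0 <= (2 * a)^-1 by rewrite invr_ge0 mulr_ge0 ?ltW.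
have Na := ler_norm (L a); have Na' := ler_norm (- L a).
have Nb := ler_norm (L b); have Nb' := ler_norm (- L b).
rewrite normrN in Na'; rewrite normrN in Nb'.
move: (normr_ge0 (L a)) (normr_ge0 (L b)) => a1 b1.
have H : 0 <= (`|L a| + `|L b|) * x ^+ 2 by rewrite mulr_ge0// addr_ge0.
have E : (`|L a| + `|L b| + (2 * a)^-1) * (1 + x ^+ 2) =
  `|L a| + `|L b| + (`|L a| + `|L b|) * x ^+ 2 + (x ^+ 2 + 1) / (2 * a).
  by ring.
have w0 : 0 <= (x ^+ 2 + 1) / (2 * a) by rewrite mulr_ge0// addr_ge0.
rewrite E ler_norml; apply/andP; split; lra.
Qed.

Section second_moment.
Variable s : R.
Hypothesis s0 : 0 < s.

Let k1 u : R := u * gauss s u.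
Let k2 u : R := u ^+ 2 * gauss s u.

Let i1 : P.-integrable setT (EFin \o (cst 1 : T -> R)).
Proof. exact: finite_measure_integrable_cst. Qed.

Let iF' : P.-integrable setT (EFin \o (fun w => 2 * F w)).
Proof. exact: integrable_fZ. Qed.

Let ik1 : leb.-integrable setT (EFin \o k1).
Proof. exact: integrable_mul_gauss. Qed.

Let ik2 : leb.-integrable setT (EFin \o k2).
Proof. exact: integrable_sqr_gauss. Qed.

(** The expansion x ^ 2 = (x - F) ^ 2 + 2 * F * (x - F) + F ^ 2 splits the moment into three
    convolutions; the factor 1 puts the first into the form weight times kernel. *)
Let A x := \int[P]_w (1 * k2 (x - F w)).
Let B x := \int[P]_w (2 * F w * k1 (x - F w)).
Let C x := \int[P]_w (F w ^+ 2 * gauss s (x - F w)).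

Let ABC x : x ^+ 2 * smooth s x = A x + B x + C x.
Proof.
have [M1 HM1] := mul_gauss_bounded s0.
have [M2 HM2] := sqr_gauss_bounded s0.
have mk1 := integrable_measurable ik1; have mk2 := integrable_measurable ik2.
have iA := integrable_rev_mul mF x mk2 HM2 i1.
have iB := integrable_rev_mul mF x mk1 HM1 iF'.
have iC := integrable_rev_mul mF x (measurable_gauss s0)
  (fun u => gauss_bounded u s0) iF2.
rewrite /A /B /C -RintegralD// -RintegralD//; last exact: integrable_fD.
rewrite -RintegralZl//; last exact: integrable_gauss_rev.
by apply: eq_Rintegral => w _; rewrite /k1 /k2 /=; ring.
Qed.

Lemma integrable_sqr_smooth :
  leb.-integrable setT (fun x => (x ^+ 2 * smooth s x)%:E).
Proof.
under eq_fun do rewrite ABC; apply: integrable_fD.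
  apply: integrable_fD; first exact: integrable_conv.
  exact: integrable_conv.
exact: integrable_conv (integrable_gauss s0).
Qed.

Lemma Rintegral_sqr_smooth : \int[leb]_x (x ^+ 2 * smooth s x) = 1 + s.
Proof.
under eq_Rintegral do rewrite ABC.
have iA := integrable_conv mF i1 ik2.
have iB := integrable_conv mF iF' ik1.
have iC := integrable_conv mF iF2 (integrable_gauss s0).
rewrite RintegralD//; last exact: integrable_fD.
rewrite RintegralD// /A /B /C !Rintegral_conv//; last exact: integrable_gauss.
rewrite Rintegral_gauss// Rintegral_sqr_gauss// RintegralZl// F1 F2.
rewrite Rintegral_cst_prob; ring.
Qed.

Lemma integrable_quadratic_smooth (C0 : R) :
  leb.-integrable setT (fun x => (C0 * (1 + x ^+ 2) * smooth s x)%:E).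
Proof.
under eq_fun => x do rewrite -mulrA mulrDl mul1r.
apply: integrable_fZ; apply: integrable_fD; first exact: integrable_smooth.
exact: integrable_sqr_smooth.
Qed.

End second_moment.

End smoothing_bounds.

(** * Entropy along the heat flow *)

Section entropy.
Context d (T : measurableType d) (R : realType) (P : probability T R).
Variable F : T -> R.
Hypothesis mF : measurable_fun setT F.
Hypothesis iF : P.-integrable setT (EFin \o F).
Hypothesis F1 : \int[P]_w F w = 0.
Hypothesis iF2 : P.-integrable setT (fun w => (F w ^+ 2)%:E).
Hypothesis F2 : \int[P]_w (F w ^+ 2) = 1.
Implicit Types (s x a b : R).
Local Notation leb := (@lebesgue_measure R).
Local Notation q := (smooth P F).
Local Notation q1 := (smooth1 P F).
Local Notation q2 := (smooth2 P F).

Let q_gt0 s x : 0 < s -> 0 < q s x.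
Proof. by move=> s0; exact: smooth_gt0. Qed.

Let q_neq0 s x : 0 < s -> q s x != 0.
Proof. by move=> s0; rewrite gt_eqF// q_gt0. Qed.

Let mq s : 0 < s -> measurable_fun setT (q s).
Proof.
by move=> s0; apply: continuous_measurable_fun; exact: continuous_smooth.
Qed.

Let mq1 s : 0 < s -> measurable_fun setT (q1 s).
Proof.
by move=> s0; apply: continuous_measurable_fun; exact: continuous_smooth1.
Qed.

Let mq2 s : 0 < s -> measurable_fun setT (q2 s).
Proof.
by move=> s0; apply: continuous_measurable_fun; exact: continuous_smooth2.
Qed.

Let mlnq s : 0 < s -> measurable_fun setT (fun x => ln (q s x)).
Proof. by move=> s0; apply: measurableT_comp => //; exact: mq. Qed.

(** The opposite of Shannon's differential entropy, hence nonincreasing along the heat flow. *)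
Definition entropy s : R := \int[leb]_x (q s x * ln (q s x)).

Definition entropy' s : R :=
  \int[leb]_x (2^-1 * q2 s x * (1 + ln (q s x))).

Definition fisher s : R := \int[leb]_x (q1 s x ^+ 2 / q s x).

Lemma integrable_entropy s : 0 < s ->
  leb.-integrable setT (fun x => (q s x * ln (q s x))%:E).
Proof.
move=> s0.
have [C [C0 HC]] := ln_smooth_bound mF iF F1 iF2 F2 s0 (lexx s).
apply: (@le_integrable_f _ _ _ leb (fun x => q s x * ln (q s x))
  (fun x => C * (1 + x ^+ 2) * q s x)).
- by apply: measurable_funM; [exact: mq|exact: mlnq].
- move=> x; rewrite normrM gtr0_norm ?q_gt0// mulrC ler_wpM2r//.
    by rewrite ltW// q_gt0.
  by apply: HC; rewrite lexx.
- exact: integrable_quadratic_smooth.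
Qed.

(** The factor 1 + ln q_s costs only a factor 1 + x ^ 2, which the second moment absorbs. *)
Let envelope_log a b (h : R -> R -> R) (C : R) : 0 < a -> a <= b ->
  (forall s x, a <= s <= b -> `|h s x| <= C * q (2 * b) x) ->
  exists C', forall s x, a <= s <= b ->
    `|h s x * (1 + ln (q s x))| <= C' * (1 + x ^+ 2) * q (2 * b) x.
Proof.
move=> a0 ab hC.
have b0 : 0 < b by exact: lt_le_trans ab.
have [L [L0 HL]] := ln_smooth_bound mF iF F1 iF2 F2 a0 ab.
exists (`|C| * (1 + L)) => s x asb.
have q0 : 0 <= q (2 * b) x by rewrite ltW// q_gt0// mulr_gt0.
rewrite normrM -mulrA [_ * q _ _]mulrC mulrA -mulrA mulrA -[leRHS]mulrA.
rewrite [leRHS](_ : _ = (`|C| * q (2 * b) x) * ((1 + L) * (1 + x ^+ 2))); last by ring.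
apply: ler_pM => //.
  by rewrite (le_trans (hC s x asb))// ler_wpM2r// ler_norm.
rewrite (le_trans (ler_normD _ _))// normr1 mulrDl mul1r lerD//.
  by rewrite lerDl sqr_ge0.
exact: HL.
Qed.

Let q2_log_envelope a b : 0 < a -> a <= b -> exists C, forall s x,
  a <= s <= b ->
  `|2^-1 * q2 s x * (1 + ln (q s x))| <= C * (1 + x ^+ 2) * q (2 * b) x.
Proof.
move=> a0 ab; have [C HC] := smooth2_envelope P mF a0 ab.
apply: (@envelope_log a b (fun s x => 2^-1 * q2 s x) (2^-1 * C)) => //.
by move=> s x asb; rewrite normrM ger0_norm// -mulrA ler_pM2l// HC.
Qed.

Let measurable_q2_log s : 0 < s ->
  measurable_fun setT (fun x => 2^-1 * q2 s x * (1 + ln (q s x))).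
Proof.
move=> s0; apply: measurable_funM.
  by apply: measurable_funM => //; exact: mq2.
by apply: measurable_funD => //; exact: mlnq.
Qed.

Lemma is_derive_entropy s : 0 < s -> is_derive s 1 entropy (entropy' s).
Proof.
move=> s0; have [h0 h2 hs] := half_double s0.
have [C HC] := q2_log_envelope h0 h2.
have pos y : y \in `]s / 2, (2 * s)[ -> 0 < y.
  by rewrite in_itv/= => /andP[hy _]; exact: lt_trans hy.
apply: (@is_derive_Rintegral _ _ _ leb (fun s x => q s x * ln (q s x))
  (fun s x => 2^-1 * q2 s x * (1 + ln (q s x))) (s / 2) (2 * s) s
  (fun x => C * (1 + x ^+ 2) * q (2 * (2 * s)) x)) => //.
- by move=> y /pos; exact: integrable_entropy.
- by apply: integrable_quadratic_smooth => //; rewrite !mulr_gt0.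
- move=> y x /pos y0; have Dq := is_derive_smooth_time P mF x y0.
  apply: (is_derive_eq (is_derive_fM Dq
    (is_derive_comp Dq (is_derive1_ln (q_gt0 x y0))))).
  by field; exact: q_neq0.
- move=> y w yI.
  by apply: HC; move: yI; rewrite in_itv/= => /andP[/ltW -> /ltW ->].
Qed.

Lemma continuous_entropy' s : 0 < s -> {for s, continuous entropy'}.
Proof.
move=> s0; have [h0 h2 hs] := half_double s0.
have [C HC] := q2_log_envelope h0 h2.
have pos y : y \in `]s / 2, (2 * s)[ -> 0 < y.
  by rewrite in_itv/= => /andP[hy _]; exact: lt_trans hy.
have ile y : y \in `]s / 2, (2 * s)[ -> s / 2 <= y <= 2 * s.
  by rewrite in_itv/= => /andP[/ltW -> /ltW ->].
have iG : leb.-integrable setT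
    (EFin \o (fun x => C * (1 + x ^+ 2) * q (2 * (2 * s)) x)).
  by apply: integrable_quadratic_smooth => //; rewrite !mulr_gt0.
apply: (@continuous_Rintegral _ _ _ leb
  (fun s x => 2^-1 * q2 s x * (1 + ln (q s x))) (s / 2) (2 * s) s
  (fun x => C * (1 + x ^+ 2) * q (2 * (2 * s)) x)) => //.
- move=> y yI; apply: le_integrable_f iG; first exact: measurable_q2_log (pos _ yI).
  by move=> x; exact: HC (ile _ yI).
- move=> y x /pos y0; have Dq := is_derive_smooth_time P mF x y0.
  apply: continuous_fM.
    by apply: continuous_fM; [exact: continuous_fC|exact: continuous_smooth2_time].
  apply: continuous_fD; first exact: continuous_fC.
  exact: is_derive_continuous
    (is_derive_comp Dq (is_derive1_ln (q_gt0 x y0))).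
- by move=> y x yI; exact: HC (ile _ yI).
Qed.

(* Cauchy-Schwarz, as the nonnegativity of
   [E ((u / s + q1 / q) ^+ 2 * gauss s u)] at [u = x - F]. *)
Let fisher_integrand_le s x : 0 < s ->
  q1 s x ^+ 2 / q s x <=
  \int[P]_w (1 * (s ^- 2 * ((x - F w) ^+ 2 * gauss s (x - F w)))).
Proof.
move=> s0; set l := q1 s x / q s x.
have ig := integrable_gauss_rev P mF x s0.
have ig1 := integrable_gauss1_rev P mF x s0.
have ig2 := integrable_sqr_gauss_rev P mF x s0.
have iA : P.-integrable setT (EFin \o
  (fun w => s ^- 2 * ((x - F w) ^+ 2 * gauss s (x - F w)))).
  exact: integrable_fZ.
have iB : P.-integrable setT (EFin \o (fun w => 2 * l * gauss1 s (x - F w))).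
  exact: integrable_fZ.
have iC : P.-integrable setT (EFin \o (fun w => l ^+ 2 * gauss s (x - F w))).
  exact: integrable_fZ.
have : 0 <= \int[P]_w (((x - F w) / s + l) ^+ 2 * gauss s (x - F w)).
  by apply: Rintegral_ge0 => w _; apply: mulr_ge0; [exact: sqr_ge0|exact: gauss_ge0].
rewrite (_ : (\int[P]_w _)%R = \int[P]_w
  (s ^- 2 * ((x - F w) ^+ 2 * gauss s (x - F w)) - 2 * l * gauss1 s (x - F w) +
  l ^+ 2 * gauss s (x - F w))); last first.
  apply: eq_Rintegral => w _; rewrite /gauss1; field.
  by rewrite gt_eqF.
rewrite RintegralD//; last exact: integrable_fB.
rewrite RintegralB// [in X in _ - X + _]RintegralZl// [in X in _ + X]RintegralZl//.
rewrite -/(q1 s x) -/(q s x) => H; under eq_Rintegral do rewrite mul1r.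
rewrite -subr_ge0; apply: le_trans H _; rewrite le_eqVlt; apply/orP; left.
apply/eqP; rewrite -addrA; congr (_ + _); rewrite /l; field.
exact: q_neq0.
Qed.

(** The bound [fisher_integrand_le] is the convolution of the law of [F] with u ^ 2 * gauss s u / s
    ^ 2. *)
Lemma integrable_fisher s : 0 < s ->
  leb.-integrable setT (fun x => (q1 s x ^+ 2 / q s x)%:E).
Proof.
move=> s0; have i1 : P.-integrable setT (EFin \o (cst 1 : T -> R)).
  exact: finite_measure_integrable_cst.
have ik : leb.-integrable setT (EFin \o (fun u => s ^- 2 * (u ^+ 2 * gauss s u))).
  by apply: integrable_fZ; exact: integrable_sqr_gauss.
apply: le_integrable_f (integrable_conv mF i1 ik).
  apply: measurable_funM; first by apply: measurable_funX; exact: mq1.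
  apply: continuous_measurable_fun => x.
  by apply: continuous_fV; [exact: q_neq0|exact: continuous_smooth].
move=> x; rewrite ger0_norm; first exact: fisher_integrand_le.
by rewrite divr_ge0 ?sqr_ge0// ltW// q_gt0.
Qed.

Let q1_log_integrable s : 0 < s ->
  leb.-integrable setT (fun x => (q1 s x * (1 + ln (q s x)))%:E).
Proof.
move=> s0; have [C HC] := smooth1_envelope P mF s0 (lexx s).
have [C' HC'] := envelope_log s0 (lexx s) HC.
apply: (@le_integrable_f _ _ _ leb _ (fun x => C' * (1 + x ^+ 2) * q (2 * s) x)).
- apply: measurable_funM; first exact: mq1.
  by apply: measurable_funD => //; exact: mlnq.
- by move=> x; apply: HC'; rewrite lexx.
- by apply: integrable_quadratic_smooth => //; rewrite mulr_gt0.
Qed.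

Let q2_log_integrable s : 0 < s ->
  leb.-integrable setT (fun x => (2^-1 * q2 s x * (1 + ln (q s x)))%:E).
Proof.
move=> s0; have [C HC] := q2_log_envelope s0 (lexx s).
apply: (@le_integrable_f _ _ _ leb _ (fun x => C * (1 + x ^+ 2) * q (2 * s) x)).
- exact: measurable_q2_log.
- by move=> x; apply: HC; rewrite lexx.
- by apply: integrable_quadratic_smooth => //; rewrite mulr_gt0.
Qed.

(** Integration by parts: the integrands of entropy' and of half the Fisher information add up to
    the derivative of q1 * (1 + ln q) / 2, whose integral vanishes. *)
Lemma entropy'_fisher s : 0 < s -> entropy' s = - (2^-1 * fisher s).
Proof.
move=> s0; apply/eqP; rewrite -addr_eq0; apply/eqP.
have iq2 := q2_log_integrable s0.
have iI := integrable_fZ 2^-1 (integrable_fisher s0).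
rewrite -RintegralZl//; last exact: integrable_fisher.
rewrite -RintegralD//.
apply: (@Rintegral_derive_eq0 _ (fun x => 2^-1 * (q1 s x * (1 + ln (q s x))))).
- move=> x; have Dq := is_derive_smooth P mF x s0.
  have Dq1 := is_derive_smooth1 P mF x s0.
  apply: (is_derive_eq (is_derive_fZ _ (is_derive_fM Dq1 (is_derive_fD
    (is_derive_fC 1 _) (is_derive_comp Dq (is_derive1_ln (q_gt0 x s0))))))).
  by field; exact: q_neq0.
- move=> x; have Dq := is_derive_smooth P mF x s0.
  apply: (@continuous_fD _ (fun x => 2^-1 * q2 s x * (1 + ln (q s x)))
    (fun x => 2^-1 * (q1 s x ^+ 2 / q s x)) x).
    apply: continuous_fM.
      apply: continuous_fM; first exact: continuous_fC.
      exact: continuous_smooth2.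
    apply: continuous_fD; first exact: continuous_fC.
    exact: is_derive_continuous
      (is_derive_comp Dq (is_derive1_ln (q_gt0 x s0))).
  apply: continuous_fM; first exact: continuous_fC.
  apply: continuous_fM; last first.
    by apply: continuous_fV; [exact: q_neq0|exact: continuous_smooth].
  apply: (@continuous_comp _ _ _ (q1 s) (fun y => y ^+ 2)).
    exact: continuous_smooth1.
  exact: continuous_fX.
- by apply: integrable_fZ; exact: q1_log_integrable.
- exact: integrable_fD.
Qed.

Let integrable_mul_smooth s : 0 < s ->
  leb.-integrable setT (fun x => (x * q s x)%:E).
Proof.
move=> s0; apply: (@le_integrable_f _ _ _ leb _
  (fun x => 1 * (1 + x ^+ 2) * q s x)).
- by apply: measurable_funM => //; exact: mq.
- move=> x; rewrite normrM (gtr0_norm (q_gt0 x s0)) mul1r.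
  rewrite ler_pM2r ?q_gt0//.
  have := sqr_ge0 (`|x| - 1); rewrite sqrrB1 real_normK ?num_real// => H.
  by have := normr_ge0 x; lra.
- exact: integrable_quadratic_smooth.
Qed.

Lemma integrable_mul_smooth1 s : 0 < s ->
  leb.-integrable setT (fun x => (x * q1 s x)%:E).
Proof.
move=> s0; have [C HC] := smooth1_envelope P mF s0 (lexx s).
apply: (@le_integrable_f _ _ _ leb _
  (fun x => `|C| * (1 + x ^+ 2) * q (2 * s) x)).
- by apply: measurable_funM => //; exact: mq1.
- move=> x; have q0 : 0 <= q (2 * s) x by rewrite ltW// q_gt0// mulr_gt0.
  rewrite normrM mulrAC mulrC; apply: ler_pM => //.
    apply: le_trans (HC s x _) _; first by rewrite lexx.
    by rewrite ler_wpM2r// ler_norm.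
  have := sqr_ge0 (`|x| - 1); rewrite sqrrB1 real_normK ?num_real// => H.
  by have := normr_ge0 x; lra.
- by apply: integrable_quadratic_smooth => //; rewrite mulr_gt0.
Qed.

Lemma Rintegral_mul_smooth1 s : 0 < s -> \int[leb]_x (x * q1 s x) = -1.
Proof.
move=> s0; have iq := integrable_smooth P mF s0.
have i1 := integrable_mul_smooth1 s0.
have : \int[leb]_x (q s x + x * q1 s x) = 0.
  apply: (@Rintegral_derive_eq0 _ (fun x => x * q s x)).
  - move=> x.
    apply: (is_derive_eq (is_derive_fM (is_derive_id _ _)
      (is_derive_smooth P mF x s0))).
    by rewrite mul1r.
  - move=> x; apply: continuous_fD; first exact: continuous_smooth.
    by apply: continuous_fM => //; exact: continuous_smooth1.
  - exact: integrable_mul_smooth.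
  - exact: integrable_fD.
rewrite RintegralD// Rintegral_smooth// => /eqP; rewrite addrC addr_eq0.
by move/eqP.
Qed.

(* The value of [E[Z (1 - tau F) | F + sqrt s Z]] at [x], once [F] has the Stein
   factor [tau]. *)
Definition score s x : R := - Num.sqrt s * ((1 + s) * (q1 s x / q s x) + x).

Let integrable_smooth1 s : 0 < s -> leb.-integrable setT (EFin \o q1 s).
Proof.
move=> s0; have [C HC] := smooth1_envelope P mF s0 (lexx s).
apply: (@le_integrable_f _ _ _ leb _ (fun x => C * q (2 * s) x)).
- exact: mq1.
- by move=> x; apply: HC; rewrite lexx.
- by apply: integrable_fZ; apply: integrable_smooth => //; rewrite mulr_gt0.
Qed.

Lemma integrable_score s : 0 < s ->
  leb.-integrable setT (fun x => (score s x * q s x)%:E).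
Proof.
move=> s0; have -> : (fun x => (score s x * q s x)%:E) = EFin \o (fun x =>
    - Num.sqrt s * ((1 + s) * q1 s x + x * q s x)).
  by apply/funext => x /=; congr EFin; rewrite /score; field; exact: q_neq0.
apply: integrable_fZ; apply: integrable_fD; last exact: integrable_mul_smooth.
by apply: integrable_fZ; exact: integrable_smooth1.
Qed.

Lemma score_sqrE s x : 0 < s -> score s x ^+ 2 * q s x =
  s * ((1 + s) ^+ 2 * (q1 s x ^+ 2 / q s x) + 2 * (1 + s) * (x * q1 s x) +
    x ^+ 2 * q s x).
Proof.
move=> s0; rewrite exprMn sqrrN sqr_sqrtr ?ltW//; field.
exact: q_neq0.
Qed.

(** With I the Fisher information, expanding the square gives (1 + s) ^ 2 * I - 2 * (1 + s) + (1 +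
    s): the cross term is -1 by parts, and q_s has second moment 1 + s. *)
Lemma Rintegral_score_sqr s : 0 < s ->
  \int[leb]_x (score s x ^+ 2 * q s x) = s * (1 + s) * ((1 + s) * fisher s - 1).
Proof.
move=> s0; under eq_Rintegral do rewrite score_sqrE//.
have iA := integrable_fZ ((1 + s) ^+ 2) (integrable_fisher s0).
have iB := integrable_fZ (2 * (1 + s)) (integrable_mul_smooth1 s0).
have iC := integrable_sqr_smooth mF iF iF2 s0.
have iAB := integrable_fD iA iB.
have iABC := integrable_fD iAB iC.
rewrite RintegralZl// RintegralD// RintegralD//.
rewrite RintegralZl//; last exact: integrable_fisher.
rewrite RintegralZl//; last exact: integrable_mul_smooth1.
rewrite Rintegral_mul_smooth1// (Rintegral_sqr_smooth mF iF F1 iF2 F2)//.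
rewrite -/(fisher s); ring.
Qed.

Lemma integrable_score_sqr s : 0 < s ->
  leb.-integrable setT (fun x => (score s x ^+ 2 * q s x)%:E).
Proof.
move=> s0; under eq_fun do rewrite score_sqrE//.
have iA := integrable_fZ ((1 + s) ^+ 2) (integrable_fisher s0).
have iB := integrable_fZ (2 * (1 + s)) (integrable_mul_smooth1 s0).
have iC := integrable_sqr_smooth mF iF iF2 s0.
by apply: integrable_fZ; apply: integrable_fD => //; exact: integrable_fD.
Qed.

Lemma measurable_score s : 0 < s -> measurable_fun setT (score s).
Proof.
move=> s0; apply: measurable_funM => //; apply: measurable_funD => //.
apply: measurable_funM => //; apply: measurable_funM; first exact: mq1.
apply: continuous_measurable_fun => x.
by apply: continuous_fV; [exact: q_neq0|exact: continuous_smooth].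
Qed.

End entropy.

(** * Transfer between a random variable and its density *)

Section law.
Context d (T : measurableType d) (R : realType) (P : probability T R).
Variables (F : T -> R) (f : R -> R).
Hypotheses (mF : measurable_fun setT F) (mf : measurable_fun setT f).
Hypothesis f0 : forall x, 0 <= f x.
Local Notation leb := (@lebesgue_measure R).
Hypothesis Ff : forall A : set R, measurable A ->
  P (F @^-1` A) = (\int[leb]_(x in A) (f x)%:E)%E.

Let F' : T -> measurableTypeR R := F.

Let mF' : measurable_fun setT F'. Proof. exact: mF. Qed.

Lemma integral_law (k : R -> R) : measurable_fun setT k ->
  P.-integrable setT (fun w => (k (F w))%:E) ->
  (\int[P]_w (k (F w))%:E = \int[leb]_y (k y * f y)%:E)%E.
Proof.
move=> mk ik.
have mEk : measurable_fun setT (EFin \o (k : measurableTypeR R -> R)).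
  exact/measurable_EFinP.
have := integral_pushforward mF' mEk (ik : P.-integrable (F' @^-1` setT) _)
  measurableT.
rewrite /= => <-.
have mf' : measurable_fun setT (f : measurableTypeR R -> R) by exact: mf.
have mk' : measurable_fun setT (k : measurableTypeR R -> R) by exact: mk.
have H := integral_density mf' f0 _ mk'.
by apply: H => A mA; exact: Ff.
Qed.

Lemma integrable_law (k : R -> R) : measurable_fun setT k ->
  leb.-integrable setT (fun y => (k y * f y)%:E) ->
  P.-integrable setT (fun w => (k (F w))%:E).
Proof.
move=> mk /integrableP[_ ik]; apply/integrableP; split.
  by apply/measurable_EFinP; exact: measurableT_comp.
have mf' : measurable_fun setT (f : measurableTypeR R -> R) by exact: mf.
have mEk : measurable_fun setT (fun y : measurableTypeR R => `|(k y)%:E|%E).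
  by do 2!apply: measurableT_comp => //.
have H := ge0_integral_density mf' f0 _ mEk (fun y => abse_ge0 _).
have := ge0_integral_pushforward mF' P measurableT mEk (fun y _ => abse_ge0 _).
rewrite /= => <-; apply: le_lt_trans ik; rewrite le_eqVlt; apply/orP; left.
apply/eqP; transitivity (\int[leb]_y (`|(k y)%:E| * (f y)%:E))%E.
  by apply: H => // A mA; exact: Ff.
by apply: eq_integral => y _; rewrite /= normrM [`|f y|]ger0_norm.
Qed.

Lemma integrable_law_density : leb.-integrable setT (EFin \o f).
Proof.
apply/integrableP; split; first exact/measurable_EFinP.
under eq_integral do rewrite /= ger0_norm//.
by rewrite -Ff// preimage_setT probability_setT ltry.
Qed.

Lemma Rintegral_law_density : \int[leb]_x f x = 1.
Proof. by rewrite /Rintegral -Ff// preimage_setT probability_setT. Qed.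

End law.

(** * Gaussian bounds on the entropy *)

Section entropy_bounds.
Context d (T : measurableType d) (R : realType) (P : probability T R).
Variable F : T -> R.
Hypothesis mF : measurable_fun setT F.
Hypothesis iF : P.-integrable setT (EFin \o F).
Hypothesis F1 : \int[P]_w F w = 0.
Hypothesis iF2 : P.-integrable setT (fun w => (F w ^+ 2)%:E).
Hypothesis F2 : \int[P]_w (F w ^+ 2) = 1.
Implicit Types (s x a b : R).
Local Notation leb := (@lebesgue_measure R).
Local Notation q := (smooth P F).

(** r ln r is convex and the left side is its tangent line at [c]. For r > 0 this is ln (c / r) <= c
    / r - 1. *)
Lemma gibbs_tangent (r c : R) : 0 <= r -> 0 < c -> r * (1 + ln c) - c <= r * ln r.
Proof.
move=> r0 c0; have [->|rn0] := eqVneq r 0; first by rewrite !mul0r; lra.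
have {}r0 : 0 < r by rewrite lt_neqAle eq_sym rn0.
have cr0 : 0 < c / r by rewrite divr_gt0.
have : ln (c / r) <= c / r - 1.
  by rewrite -[X in ln X](subrK 1) addrC le_ln1Dx//; lra.
rewrite ln_div ?posrE// -(ler_pM2l r0) !mulrBr.
rewrite [r * (c / r)](_ : _ = c); last by field; rewrite gt_eqF.
lra.
Qed.

(** [gibbs_tangent] at c = expR (h x), integrated: the linearised Donsker-Varadhan variational
    bound. Quadratic growth of [h] makes h * q_s integrable. *)
Lemma entropy_ge s (h : R -> R) (C : R) : 0 < s -> measurable_fun setT h ->
  (forall x, `|h x| <= C * (1 + x ^+ 2)) ->
  leb.-integrable setT (fun x => (expR (h x))%:E) ->
  1 + \int[leb]_x (h x * q s x) - \int[leb]_x expR (h x) <= entropy P F s.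
Proof.
move=> s0 mh hC ie.
have iq := integrable_smooth P mF s0.
have ih : leb.-integrable setT (fun x => (h x * q s x)%:E).
  apply: (@le_integrable_f _ _ _ leb _ (fun x => C * (1 + x ^+ 2) * q s x)).
  - by apply: measurable_funM => //; exact: integrable_measurable iq.
  - move=> x; have q0 := smooth_gt0 mF iF F1 iF2 F2 x s0.
    by rewrite normrM (gtr0_norm q0) ler_pM2r.
  - exact: integrable_quadratic_smooth.
rewrite -(Rintegral_smooth P mF s0) -RintegralD// -RintegralB//; last first.
  exact: integrable_fD.
apply: le_Rintegral => //.
- by apply: integrable_fB => //; exact: integrable_fD.
- exact: integrable_entropy.
move=> x _.
have := gibbs_tangent (ltW (smooth_gt0 mF iF F1 iF2 F2 x s0)) (expR_gt0 (h x)).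
by rewrite expRK; apply: le_trans; rewrite mulrDr mulr1 [q s x * _]mulrC.
Qed.

Lemma lgauss_bound s : 0 < s ->
  exists C, 0 <= C /\ forall x, `|lgauss s x| <= C * (1 + x ^+ 2).
Proof.
move=> s0; have t0 : 0 <= (2 * s)^-1 by rewrite invr_ge0 mulr_ge0 ?ltW.
exists (`|ln (2 * pi * s) / 2| + (2 * s)^-1); split; first by rewrite addr_ge0.
move=> x; rewrite /lgauss (le_trans (ler_normB _ _))// normrN.
rewrite [`|_ / (2 * s)|]ger0_norm ?divr_ge0 ?sqr_ge0 ?mulr_ge0 ?(ltW s0)//.
move: (normr_ge0 (ln (2 * pi * s) / 2)) (sqr_ge0 x) t0.
move: `|ln (2 * pi * s) / 2| (x ^+ 2) (2 * s)^-1 => A y B A0 y0 B0.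
have := mulr_ge0 A0 y0; lra.
Qed.

Lemma measurable_lgauss s : measurable_fun setT (lgauss s).
Proof. by apply: measurable_funB => //; apply: measurable_funM. Qed.

Lemma Rintegral_lgauss_smooth s r : 0 < s ->
  \int[leb]_x (lgauss r x * q s x) =
  - (ln (2 * pi * r) / 2) - (1 + s) / (2 * r).
Proof.
move=> s0; have iq := integrable_smooth P mF s0.
have iq2 := integrable_sqr_smooth mF iF iF2 s0.
rewrite (_ : (\int[leb]_x _)%R = \int[leb]_x
  (- (ln (2 * pi * r) / 2) * q s x - (2 * r)^-1 * (x ^+ 2 * q s x))); last first.
  by apply: eq_Rintegral => x _; rewrite /lgauss; ring.
rewrite RintegralB//; [|exact: integrable_fZ|exact: integrable_fZ].
rewrite !RintegralZl// Rintegral_smooth// (Rintegral_sqr_smooth mF iF F1 iF2 F2)//.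
by ring.
Qed.

(** Test against the Gaussian with the variance 1 + s of q_s: it maximises Shannon entropy among
    laws of that variance. *)
Lemma entropy_lb s : 0 < s ->
  - (ln (2 * pi * (1 + s)) / 2) - 2^-1 <= entropy P F s.
Proof.
move=> s0; have r0 : 0 < 1 + s by rewrite addr_gt0.
have [C [_ HC]] := lgauss_bound r0.
have := entropy_ge s0 (measurable_lgauss _) HC (integrable_gauss r0).
rewrite Rintegral_lgauss_smooth// -/(gauss _ _) (Rintegral_gauss r0).
apply: le_trans; rewrite [(1 + s) / _](_ : _ = 2^-1); first by lra.
by field; rewrite gt_eqF.
Qed.

(** q_s is a mixture of translates of [gauss s], so by convexity of r ln r its entropy is at most
    that of [gauss s]. *)
Lemma entropy_ub s : 0 < s -> entropy P F s <= - (ln (2 * pi * s) / 2) - 2^-1.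
Proof.
move=> s0; have iq := integrable_smooth P mF s0.
have ig2 := integrable_sqr_gauss s0.
have i1 : P.-integrable setT (EFin \o (cst 1 : T -> R)).
  exact: finite_measure_integrable_cst.
pose L : R := ln (2 * pi * s) / 2.
pose Q x : R := \int[P]_w (1 * ((x - F w) ^+ 2 * gauss s (x - F w))).
have iQ : leb.-integrable setT (EFin \o Q) := integrable_conv mF i1 ig2.
have iLq := integrable_fZ (- L) iq.
have icQ := integrable_fZ (2 * s)^-1 iQ.
have -> : - L - 2^-1 = \int[leb]_x (- L * q s x - (2 * s)^-1 * Q x).
  rewrite RintegralB// !RintegralZl// Rintegral_smooth//.
  rewrite (Rintegral_conv mF i1 ig2) Rintegral_sqr_gauss// Rintegral_cst_prob.
  by field; rewrite gt_eqF.
apply: le_Rintegral => //; [exact: integrable_entropy|exact: integrable_fB|].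
move=> x _; have q0 := smooth_gt0 mF iF F1 iF2 F2 x s0.
have ig := integrable_gauss_rev P mF x s0.
have i2 := integrable_sqr_gauss_rev P mF x s0.
have iA : P.-integrable setT (EFin \o
    (fun w => (1 + ln (q s x)) * gauss s (x - F w))) by exact: integrable_fZ.
have iB : P.-integrable setT (EFin \o (fun w => - L * gauss s (x - F w))).
  exact: integrable_fZ.
have iC : P.-integrable setT (EFin \o
    (fun w => (2 * s)^-1 * ((x - F w) ^+ 2 * gauss s (x - F w)))).
  exact: integrable_fZ.
(* Since gauss s (x - F) has mean q_s(x), the tangent at q_s(x) averages to exactly q ln q. *)
have -> : q s x * ln (q s x) =
    \int[P]_w ((1 + ln (q s x)) * gauss s (x - F w) - q s x).
  rewrite RintegralB//; last exact: finite_measure_integrable_cst.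
  rewrite RintegralZl// Rintegral_cst_prob -/(smooth P F s x); ring.
have -> : - L * q s x - (2 * s)^-1 * Q x = \int[P]_w (- L * gauss s (x - F w) -
    (2 * s)^-1 * ((x - F w) ^+ 2 * gauss s (x - F w))).
  rewrite RintegralB// !RintegralZl//; congr (_ - _ * _).
  by apply: eq_Rintegral => w _; rewrite mul1r.
apply: le_Rintegral => //.
- by apply: integrable_fB => //; exact: finite_measure_integrable_cst.
- exact: integrable_fB.
move=> w _; have := gibbs_tangent (gauss_ge0 s (x - F w)) q0.
rewrite [_ * (1 + _)]mulrC; move=> /le_trans; apply.
rewrite ln_gauss /lgauss -/L le_eqVlt; apply/orP; left; apply/eqP.
by ring.
Qed.

End entropy_bounds.

(** * Conditioning on the noised variable *)

Section joint_law.
Context (R : realType) d (T : measurableType d) (P : probability T R).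
Variables F Z : {RV P >-> R}.
Hypothesis Z_normal : is_normal Z 0 1.
Hypothesis FZ_indep : independent_RVs F Z.
Variable s : R.
Hypothesis s0 : 0 < s.
Local Notation leb := (@lebesgue_measure R).

Let mF : measurable_fun setT (F : T -> R). Proof. exact: measurable_funP. Qed.
Let mZ : measurable_fun setT (Z : T -> R). Proof. exact: measurable_funP. Qed.

Definition noised (w : T) : R := F w + Num.sqrt s * Z w.

Lemma measurable_noised : measurable_fun setT noised.
Proof. by apply: measurable_funD => //; exact: measurable_funM. Qed.

Let FZ (w : T) : R * measurableTypeR R := (F w, Z w).

Let mFZ : measurable_fun setT FZ.
Proof. exact/measurable_fun_pair. Qed.

Let gamma : {measure set (measurableTypeR R) -> \bar R} := normal_prob 0 1.

(** Independence and the law of [Z] determine the joint law on rectangles, hence everywhere. *)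
Let lawFZ (A : set (R * measurableTypeR R)) : measurable A ->
  pushforward P FZ A = (distribution P F \x normal_prob 0 1)%E A.
Proof.
move=> mA; apply/esym.
have H := @product_measure_unique _ _ _ _ _ (distribution P F)
  (normal_prob 0 1) (pushforward P FZ) _ A mA.
apply: H => // A1 A2 mA1 mA2.
transitivity (distribution P F A1 * distribution P Z A2)%E; last first.
  by congr (_ * _)%E; exact: Z_normal.
rewrite /distribution /pushforward -(FZ_indep mA1 mA2).
by congr (P _); apply/seteqP; split.
Qed.

(** Given F = y, the noised variable has density gauss s (x - y). The proof is Tonelli for the law
    of (F, Z), then the affine substitution x = F w + sqrt s * z for each w. *)
Lemma ge0_integral_noised (W : R * R -> \bar R) :
  measurable_fun setT W -> (forall p, 0 <= W p)%E ->
  (\int[P]_w W (F w, noised w) =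
   \int[P]_w \int[leb]_x (W (F w, x) * (gauss s (x - F w))%:E))%E.
Proof.
move=> mW W0.
pose W' (p : R * measurableTypeR R) : \bar R :=
  W (p.1, p.1 + Num.sqrt s * p.2).
have mW' : measurable_fun setT W'.
  apply: (measurableT_comp mW); apply/measurable_fun_pair => /=.
    exact: measurable_fst.
  apply: measurable_funD; first exact: measurable_fst.
  by apply: measurable_funM => //; exact: measurable_snd.
have -> : (\int[P]_w W (F w, noised w) = \int[pushforward P FZ]_p W' p)%E.
  by rewrite ge0_integral_pushforward// => p _; exact: W0.
rewrite (eq_measure_integral (distribution P F \x normal_prob 0 1)%E); last first.
  by move=> A mA _; exact: lawFZ.
have W'0 p : (0 <= W' p)%E by exact: W0.
have mFF := @measurable_fun_fubini_tonelli_F _ _ _ _ _ (normal_prob 0 1)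
  W' mW' W'0.
have FF0 y : (0 <= fubini_F (normal_prob 0 1) W' y)%E.
  by apply: integral_ge0 => z _.
rewrite (fubini_tonelli1 W' mW' W'0).
rewrite (ge0_integral_distribution F mFF FF0).
apply: eq_integral => w _.
have mWw : measurable_fun setT (fun x => W (F w, x)).
  by apply: (measurableT_comp mW); apply/measurable_fun_pair.
rewrite [RHS](@ge0_integral_affine _ (F w) (Num.sqrt s)); last 3 first.
- by rewrite sqrtr_gt0.
- apply: emeasurable_funM => //; apply/measurable_EFinP.
  apply: measurableT_comp; first exact: measurable_gauss.
  exact: measurable_funB.
- by move=> x; rewrite mule_ge0// lee_fin gauss_ge0.
rewrite /= /fubini_F.
have mW'w : measurable_fun setT (fun z => W' (F w, z)).
  by apply: (measurableT_comp mW'); apply/measurable_fun_pair.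
have mN : measurable_fun setT
    (normal_pdf 0 1 : measurableTypeR R -> R) := measurable_normal_pdf 0 1.
have H := @ge0_integral_density _ _ _ leb gamma (normal_pdf 0 1) mN
  (normal_pdf_ge0 0 1) (fun A _ => erefl) _ mW'w (fun z => W'0 _).
rewrite [LHS]H -ge0_integralZl//=; first last.
- by move=> z _; rewrite mule_ge0// lee_fin gauss_ge0.
- apply: emeasurable_funM; first exact: mW'w.
  apply/measurable_EFinP; apply: measurableT_comp.
    exact: measurable_gauss.
  apply: measurable_funB => //; apply: measurable_funD => //.
apply: eq_integral => z _.
rewrite /W' /= muleCA -EFinM; congr (_ * _%:E)%E.
by rewrite addrC addKr gauss_scale// gauss_normal_pdf// sqrtr1.
Qed.

Section integrand.
Variable W : R * R -> R.
Hypothesis mW : measurable_fun setT W.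

Let phi (p : T * R) : \bar R := (W (F p.1, p.2) * gauss s (p.2 - F p.1))%:E.

Let mWF : measurable_fun setT (fun p : T * R => W (F p.1, p.2)).
Proof.
apply: (measurableT_comp mW); apply/measurable_fun_pair => /=.
  by apply: (measurableT_comp mF); exact: measurable_fst.
exact: measurable_snd.
Qed.

Let mgF : measurable_fun setT (fun p : T * R => gauss s (p.2 - F p.1)).
Proof.
apply: measurableT_comp; first exact: measurable_gauss.
apply: measurable_funB; first exact: measurable_snd.
by apply: (measurableT_comp mF); exact: measurable_fst.
Qed.

Let mWn : measurable_fun setT (fun w => W (F w, noised w)).
Proof.
apply: (measurableT_comp mW); apply/measurable_fun_pair => //.
exact: measurable_noised.
Qed.

(** [V] will be the absolute value and the positive and negative parts, reducing signed integrands
    to the nonnegative case. *)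
Let ge0_noised (V : R -> R) : measurable_fun setT V -> (forall r, 0 <= V r) ->
  (\int[P]_w (V (W (F w, noised w)))%:E = \int[P \x leb]_p
    (V (W (F p.1, p.2)) * gauss s (p.2 - F p.1))%:E)%E.
Proof.
move=> mV V0; have mVW : measurable_fun setT (fun p => (V (W p))%:E).
  by apply/measurable_EFinP; exact: measurableT_comp.
rewrite (ge0_integral_noised mVW); last by move=> p; rewrite lee_fin.
rewrite fubini_tonelli1//=.
- apply/measurable_EFinP; apply: measurable_funM => //.
  exact: (measurableT_comp mV mWF).
- by move=> p; rewrite lee_fin mulr_ge0// gauss_ge0.
Qed.

Lemma integrable_noised : (P \x leb)%E.-integrable setT phi ->
  P.-integrable setT (fun w => (W (F w, noised w))%:E).
Proof.
move=> /integrableP[_ iphi]; apply/integrableP; split.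
  exact/measurable_EFinP.
rewrite (@ge0_noised (fun r => `|r|))//.
move: iphi; congr (_ < _)%E; apply: eq_integral => p _.
by rewrite /phi /= normrM [`|gauss _ _|]ger0_norm ?gauss_ge0.
Qed.

Lemma Rintegral_noised : (P \x leb)%E.-integrable setT phi ->
  (forall x, P.-integrable setT
    (fun w => (W (F w, x) * gauss s (x - F w))%:E)) ->
  \int[P]_w W (F w, noised w) =
  \int[leb]_x \int[P]_w (W (F w, x) * gauss s (x - F w)).
Proof.
move=> iphi iphix; have i1 := integrable_noised iphi.
have max_ge0 (r : R) : 0 <= Num.max r 0 by rewrite le_max lexx orbT.
transitivity (fine (\int[P \x leb]_p phi p)%E).
  congr fine; rewrite integralE [RHS]integralE; congr (_ - _)%E.
  - transitivity (\int[P]_w (Num.max (W (F w, noised w)) 0)%:E)%E.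
      by apply: eq_integral => w _; rewrite funeposE EFin_max.
    rewrite (@ge0_noised (fun r => Num.max r 0))//; last first.
      exact: measurable_maxr.
    apply: eq_integral => p _; rewrite funeposE /phi -EFin_max.
    by rewrite maxr_pMl ?gauss_ge0// mul0r.
  - transitivity (\int[P]_w (Num.max (- W (F w, noised w)) 0)%:E)%E.
      by apply: eq_integral => w _; rewrite funenegE EFin_max.
    rewrite (@ge0_noised (fun r => Num.max (- r) 0))//; last first.
      by apply: measurable_maxr.
    apply: eq_integral => p _; rewrite funenegE /phi -EFinN -EFin_max.
    by rewrite maxr_pMl ?gauss_ge0// mul0r mulNr.
rewrite -integral21_prod_meas1//; congr fine; apply: eq_integral => x _.
by rewrite EFin_Rintegral//; exact: iphix.
Qed.

End integrand.

(** The common shape of the integrands below: an event on G_s, a weight on the sample space, a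
    kernel. Integrability of [k] serves the product space, its boundedness each fibre. *)
Let integrable_fiber (B : set R) (h : T -> R) (k : R -> R) (M : R) :
  measurable B -> P.-integrable setT (EFin \o h) ->
  leb.-integrable setT (EFin \o k) -> (forall u, `|k u| <= M) ->
  (P \x leb)%E.-integrable setT
    (fun p : T * R => (\1_B p.2 * (h p.1 * k (p.2 - F p.1)))%:E) /\
  forall x, P.-integrable setT
    (fun w => (\1_B x * (h w * k (x - F w)))%:E).
Proof.
move=> mB ih ik kM; have mk := integrable_measurable ik.
split; last first.
  by move=> x; apply: integrable_fZ; apply: integrable_rev_mul kM ih.
have iP := integrable_conv_prod mF ih ik.
have mB1 : measurable_fun setT (fun p : T * R => \1_B p.2 : R).
  apply: (measurableT_comp (measurable_indic mB)); exact: measurable_snd.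
apply: (@le_integrable_f _ _ _ (P \x leb)%E _
  (fun p : T * R => `|h p.1 * k (p.2 - F p.1)|)).
- apply: measurable_funM => //.
  by apply/measurable_EFinP; exact: measurable_int iP.
- move=> p; rewrite normrM ler_piMl//.
  by rewrite indicE; case: (_ \in _); rewrite ?normr1 ?normr0.
- exact: integrable_norm iP.
Qed.

Let i1 : P.-integrable setT (EFin \o (cst 1 : T -> R)).
Proof. exact: finite_measure_integrable_cst. Qed.

Lemma law_noised (A : set R) : measurable A ->
  P (noised @^-1` A) = (\int[leb]_(x in A) (smooth P F s x)%:E)%E.
Proof.
move=> mA.
have [iphi iphix] := integrable_fiber mA i1 (integrable_gauss s0)
  (fun u => gauss_bounded u s0).
pose W (p : R * R) : R := \1_A p.2.
have mW : measurable_fun setT W.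
  apply: (measurableT_comp (measurable_indic mA)); exact: measurable_snd.
have E (x : R) (w : T) : \1_A x * (cst 1 w * gauss s (x - F w)) =
    W (F w, x) * gauss s (x - F w) by rewrite /= mul1r.
have mnA : measurable (noised @^-1` A).
  by rewrite -[X in measurable X]setTI; exact: measurable_noised.
have H : \int[P]_w W (F w, noised w) =
    \int[leb]_x \int[P]_w (W (F w, x) * gauss s (x - F w)).
  apply: Rintegral_noised => //.
    by apply: eq_integrable iphi => // p _; rewrite E.
  by move=> x; apply: eq_integrable (iphix x) => // w _; rewrite E.
have iq := integrable_smooth P mF s0.
have iqA : leb.-integrable setT (fun x => (\1_A x * smooth P F s x)%:E).
  apply: le_integrable_f (integrable_norm iq).
    apply: measurable_funM; first exact: measurable_indic.
    exact: integrable_measurable iq.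
  move=> x; rewrite normrM ler_piMl//.
  by rewrite indicE; case: (_ \in _); rewrite ?normr1 ?normr0.
have -> : P (noised @^-1` A) = (\int[P]_w W (F w, noised w))%:E.
  rewrite EFin_Rintegral; last first.
    apply: (@integrable_bounded _ _ _ P _ 1) => /=.
      by apply: (measurableT_comp (measurable_indic mA)); exact: measurable_noised.
    by move=> w; rewrite /W /= indicE; case: (_ \in _); rewrite ?normr1 ?normr0.
  by rewrite -[X in P X](setIT (noised @^-1` A)) -integral_indic.
rewrite H; transitivity (\int[leb]_x (\1_A x * smooth P F s x)%:E)%E.
  rewrite -EFin_Rintegral//; congr EFin; apply: eq_Rintegral => x _.
  by rewrite /W /= RintegralZl//; exact: integrable_gauss_rev.
rewrite [RHS]integral_mkcond; apply: eq_integral => x _.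
by rewrite patchE indicE; case: ifP => _; rewrite ?mul1r ?mul0r.
Qed.

Section stein.
Variable tau : R -> R.
Hypothesis mtau : measurable_fun setT tau.
Hypothesis itau : P.-integrable setT (fun w => (tau (F w))%:E).
Hypothesis q_gt0 : forall x, 0 < smooth P F s x.
Hypothesis stein_gauss : forall x,
  \int[P]_w (F w * gauss s (x - F w)) =
  - \int[P]_w (tau (F w) * gauss1 s (x - F w)).

(** When G_s = x, [Z] equals (x - F) / sqrt s; so h * k (x - F) is Z (1 - tau F) weighted by the
    conditional density of G_s at [x]. *)
Let k u : R := (Num.sqrt s)^-1 * (u * gauss s u).

Let h w : R := 1 - tau (F w).

Let ik : leb.-integrable setT (EFin \o k).
Proof. by apply: integrable_fZ; exact: integrable_mul_gauss. Qed.

Let k_bounded : exists M, forall u, `|k u| <= M.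
Proof.
have [M HM] := mul_gauss_bounded s0.
by exists (`|(Num.sqrt s)^-1| * M) => u; rewrite normrM ler_wpM2l.
Qed.

Let ih : P.-integrable setT (EFin \o h).
Proof. exact: integrable_fB. Qed.

Let kE u : k u = - Num.sqrt s * gauss1 s u.
Proof.
rewrite /k /gauss1 -[X in u / X](sqr_sqrtr (ltW s0)).
by field; rewrite gt_eqF ?sqrtr_gt0.
Qed.

(* Stein's identity for [fun y => gauss s (x - y)] turns the integral of
   [tau (F w) * gauss1 s (x - F w)] into one of [F w * gauss s (x - F w)]. *)
Let Rintegral_hk x : \int[P]_w (h w * k (x - F w)) =
  score P F s x * smooth P F s x.
Proof.
have [M1 HM1] := gauss1_bounded s0.
have ig := integrable_gauss_rev P mF x s0.
have ig1 := integrable_gauss1_rev P mF x s0.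
have it1 := integrable_rev_mul mF x (measurable_gauss1 s0) HM1 itau.
have q0 : smooth P F s x != 0 by rewrite gt_eqF.
have r0 : Num.sqrt s != 0 by rewrite gt_eqF ?sqrtr_gt0.
(* Write F = x - (x - F) and use u * gauss s u = - s * gauss1 s u. *)
have xF : \int[P]_w (F w * gauss s (x - F w)) =
    x * smooth P F s x + s * smooth1 P F s x.
  rewrite /smooth /smooth1 -RintegralZl// -RintegralZl// -RintegralD//.
  - apply: eq_Rintegral => w _; rewrite /= /gauss1.
    move: (F w) => y; move: (gauss s (x - y)) => g.
    by field; rewrite gt_eqF.
  - exact: integrable_fZ.
  - exact: integrable_fZ.
transitivity (\int[P]_w (- Num.sqrt s * gauss1 s (x - F w) -
    - Num.sqrt s * (tau (F w) * gauss1 s (x - F w)))).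
  by apply: eq_Rintegral => w _; rewrite kE /h; ring.
have iA : P.-integrable setT
    (EFin \o (fun w => - Num.sqrt s * gauss1 s (x - F w))).
  exact: integrable_fZ.
have iB : P.-integrable setT
    (EFin \o (fun w => - Num.sqrt s * (tau (F w) * gauss1 s (x - F w)))).
  exact: integrable_fZ.
rewrite RintegralB// !RintegralZl//.
have := stein_gauss x; rewrite xF => /eqP; rewrite eq_sym eqr_oppLR => /eqP ->.
by rewrite /score -/(smooth1 P F s x); field.
Qed.

Hypothesis mscore : measurable_fun setT (score P F s).
Hypothesis iscore : leb.-integrable setT
  (fun x => (score P F s x * smooth P F s x)%:E).

Let noisedB w : (noised w - F w) / Num.sqrt s = Z w.
Proof.
by rewrite /noised addrC addKr mulrC mulKf// gt_eqF// sqrtr_gt0.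
Qed.

(** Recovers Z (1 - tau F) on the event that G_s lies in [B] from the pair (F, G_s) alone. *)
Let W (B : set R) (p : R * R) : R :=
  \1_B p.2 * ((p.2 - p.1) / Num.sqrt s * (1 - tau p.1)).

Let mW B : measurable B -> measurable_fun setT (W B).
Proof.
move=> mB; apply: measurable_funM.
  by apply: (measurableT_comp (measurable_indic mB)); exact: measurable_snd.
apply: measurable_funM.
  apply: measurable_funM => //.
  by apply: measurable_funB; [exact: measurable_snd|exact: measurable_fst].
apply: measurable_funB => //.
by apply: (measurableT_comp mtau); exact: measurable_fst.
Qed.

Let WE B (x : R) (w : T) : \1_B x * (h w * k (x - F w)) =
  W B (F w, x) * gauss s (x - F w).
Proof. by rewrite /W /h /k /=; ring. Qed.

Let W_noised B w :
  W B (F w, noised w) = \1_B (noised w) * (Z w * (1 - tau (F w))).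
Proof. by rewrite /W /= noisedB. Qed.

Let integrable_W B : measurable B -> (P \x leb)%E.-integrable setT
  (fun p => (W B (F p.1, p.2) * gauss s (p.2 - F p.1))%:E).
Proof.
move=> mB; have [M HM] := k_bounded.
have [iphi _] := integrable_fiber mB ih ik HM.
by apply: eq_integrable iphi => // p _; rewrite WE.
Qed.

Lemma integrable_noised_score :
  P.-integrable setT (fun w => (score P F s (noised w))%:E).
Proof.
have iq := integrable_smooth P mF s0.
apply: (@integrable_law _ _ _ P noised (smooth P F s)) => //.
- exact: measurable_noised.
- exact: integrable_measurable iq.
- by move=> x; rewrite ltW.
- exact: law_noised.
Qed.

(** Both sides equal the integral over [B] of score * q_s: the left by the joint law and
    [Rintegral_hk], the right because q_s is the density of G_s. *)
Lemma noised_cond_integral (B : set R) : measurable B ->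
  (\int[P]_(w in noised @^-1` B) (Z w * (1 - tau (F w)))%:E =
   \int[P]_(w in noised @^-1` B) (score P F s (noised w))%:E)%E.
Proof.
move=> mB; have [M HM] := k_bounded.
have [iphi iphix] := integrable_fiber mB ih ik HM.
have toB (V : T -> R) : (\int[P]_(w in noised @^-1` B) (V w)%:E =
    \int[P]_w (\1_B (noised w) * V w)%:E)%E.
  rewrite [LHS]integral_mkcond; apply: eq_integral => w _.
  rewrite patchE indicE -[w \in _]/(noised w \in B).
  by case: ifP => _; rewrite ?mul1r ?mul0r.
rewrite !toB.
transitivity (\int[P]_w (W B (F w, noised w))%:E)%E.
  by apply: eq_integral => w _; rewrite W_noised.
have iW := integrable_noised (mW mB) (integrable_W mB).
rewrite -EFin_Rintegral// (Rintegral_noised (mW mB) (integrable_W mB)); last first.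
  by move=> x; apply: eq_integrable (iphix x) => // w _; rewrite WE.
have iBs : leb.-integrable setT
    (fun x => (\1_B x * score P F s x * smooth P F s x)%:E).
  apply: le_integrable_f (integrable_norm iscore).
    apply: measurable_funM; last exact: integrable_measurable
      (integrable_smooth P mF s0).
    by apply: measurable_funM => //; exact: measurable_indic.
  move=> x; rewrite -mulrA normrM ler_piMl//.
  by rewrite indicE; case: (_ \in _); rewrite ?normr1 ?normr0.
transitivity (\int[leb]_x (\1_B x * score P F s x * smooth P F s x)%:E)%E.
  rewrite -EFin_Rintegral//; congr EFin; apply: eq_Rintegral => x _.
  rewrite -mulrA -Rintegral_hk -RintegralZl//; last first.
    exact: (integrable_rev_mul mF x (integrable_measurable ik) HM ih).
  by apply: eq_Rintegral => w _; rewrite WE.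
have iq := integrable_smooth P mF s0.
have q0 x : 0 <= smooth P F s x by rewrite ltW.
have mBs : measurable_fun setT (fun x => \1_B x * score P F s x).
  by apply: measurable_funM => //; exact: measurable_indic.
have iBn := integrable_law measurable_noised (integrable_measurable iq) q0
  law_noised mBs iBs.
exact/esym/(integral_law measurable_noised (integrable_measurable iq) q0
  law_noised mBs iBn).
Qed.

End stein.

End joint_law.

Section cond_expectation_unique.
Context d d' (T : measurableType d) (T' : measurableType d') (R : realType).
Context (P : probability T R) (X : T -> R) (Y : T -> T').
Hypothesis mY : measurable_fun setT Y.

Let sigma_measurable (A : set T) : g_sigma_algebra_preimage Y A -> measurable A.
Proof. by move=> [B mB <-]; exact: mY. Qed.

Let sigma_measurable_fun (G : T -> R) :
  measurable_fun [set: g_sigma_algebra_preimageType Y] G ->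
  measurable_fun setT G.
Proof. by move=> mG _ B mB; apply: sigma_measurable; exact: mG. Qed.

(** The event where G >= G' and its complement lie in the sigma-algebra of [Y], and G - G'
    integrates to 0 on each; hence |G - G'| has integral 0. *)
Lemma is_cond_expectation_unique (G G' : T -> R) :
  is_cond_expectation P X Y G -> is_cond_expectation P X Y G' ->
  ae_eq P setT (EFin \o G) (EFin \o G').
Proof.
move=> [mG iG GX] [mG' iG' GX'].
pose D w := G w - G' w.
have mD : measurable_fun [set: g_sigma_algebra_preimageType Y] D.
  exact: measurable_funB.
have iD : P.-integrable setT (EFin \o D) by exact: integrable_fB.
have D0 A : g_sigma_algebra_preimage Y A -> (\int[P]_(w in A) (D w)%:E = 0)%E.
  move=> sA; have mA := sigma_measurable sA.
  have iGA : P.-integrable A (EFin \o G) by apply: integrableS iG.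
  have iGA' : P.-integrable A (EFin \o G') by apply: integrableS iG'.
  under eq_integral do rewrite EFinB.
  rewrite integralB//= GX// GX'// subee// -GX'//.
  exact: integrable_fin_num.
pose A := setT `&` D @^-1` `[0, +oo[.
have sA : g_sigma_algebra_preimage Y A by exact: (mD measurableT).
have sAC : g_sigma_algebra_preimage Y (~` A).
  exact: (@measurableC _ (g_sigma_algebra_preimageType Y)).
have mA := sigma_measurable sA.
have iDC : P.-integrable (~` A) (EFin \o D).
  by apply: integrableS iD => //; exact: measurableC.
have : (\int[P]_w `|(D w)%:E| = 0)%E.
  have mDE : measurable_fun setT (fun w => `|(D w)%:E|%E).
    apply: measurableT_comp => //; apply/measurable_EFinP.
    exact: sigma_measurable_fun.
  rewrite -(setUv A) ge0_integral_setU//; last 3 first.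
  - exact: measurableC.
  - by rewrite setUv.
  - by rewrite disj_set2E setICr eqxx.
  rewrite -[RHS]adde0; congr (_ + _)%E.
    rewrite -[RHS](D0 _ sA); apply: eq_integral => w /[!inE] -[_] /=.
    by rewrite in_itv/= andbT => w0; rewrite ger0_norm.
  rewrite -[RHS]oppe0 -[in RHS](D0 _ sAC) -integralN/=; last first.
    have fin := integrable_add_def (measurableC mA) iDC; exact: fin.
  apply: eq_integral => w /[!inE] Aw /=; rewrite ler0_norm//.
  case: (ltP (D w) 0) => [/ltW//|w0].
  by exfalso; apply: Aw; split => //=; rewrite in_itv/= w0.
move=> /ae_eq_integral_abs H.
have {}H := H measurableT (measurable_int _ iD).
apply: filterS H => w /= + _ => /(_ I) [Dw].
by congr EFin; apply/eqP; rewrite -subr_eq0; apply/eqP.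
Qed.

Lemma expectation_cond_sqr (G : T -> R) : is_cond_expectation P X Y G ->
  ('E_P[fun w => (cond_expectation P X Y w ^+ 2)%R] =
   \int[P]_w (G w ^+ 2)%:E)%E.
Proof.
(* [G] shows that versions exist, so [xget] does not fall back on its default 0. *)
move=> XG; have XC : is_cond_expectation P X Y (cond_expectation P X Y).
  exact: (@xgetPex _ (fun=> 0) [set G | is_cond_expectation P X Y G]
    (ex_intro _ G XG)).
rewrite unlock; have [mG _ _] := XG; have [mC _ _] := XC.
apply: ae_eq_integral => //.
- by apply/measurable_EFinP/measurable_funX; exact: sigma_measurable_fun.
- by apply/measurable_EFinP/measurable_funX; exact: sigma_measurable_fun.
have := is_cond_expectation_unique XC XG.
by apply: filterS => w /= H _; have [->] := H I.
Qed.

End cond_expectation_unique.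

Section cond_expectation_noised.
Context (R : realType) d (T : measurableType d) (P : probability T R).
Variables (F Z : {RV P >-> R}) (tau : R -> R).
Hypothesis Z_normal : is_normal Z 0 1.
Hypothesis FZ_indep : independent_RVs F Z.
Hypothesis F_tau : is_Stein_factor F tau.
Hypothesis iF : P.-integrable setT (EFin \o (F : T -> R)).
Hypothesis F1 : \int[P]_w F w = 0.
Hypothesis iF2 : P.-integrable setT (fun w => (F w ^+ 2)%:E).
Hypothesis F2 : \int[P]_w (F w ^+ 2) = 1.
Local Notation leb := (@lebesgue_measure R).

Let mF : measurable_fun setT (F : T -> R). Proof. exact: measurable_funP. Qed.

(** The test function gauss s (x - y) and its derivative are bounded, so integrability of [F] and of
    tau (F) makes both expectations well defined. *)
Lemma stein_gauss s x : 0 < s ->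
  \int[P]_w (F w * gauss s (x - F w)) =
  - \int[P]_w (tau (F w) * gauss1 s (x - F w)).
Proof.
move=> s0; have [mtau itau stein] := F_tau.
have [M1 HM1] := gauss1_bounded s0.
pose g y := gauss s (x - y).
have Dg (y : R) : is_derive y 1 g (- gauss1 s (x - y)).
  apply: (is_derive_eq (is_derive_comp (is_derive_rev x y)
    (is_derive_gauss (x - y) s0))).
  by rewrite mulrN1.
have g'E : (g^`())%classic = fun y => - gauss1 s (x - y).
  by apply/funext => y; have ? := Dg y; rewrite derive1E derive_val.
have it1 := integrable_rev_mul mF x (measurable_gauss1 s0) HM1 itau.
have iFg := integrable_rev_mul mF x (measurable_gauss s0)
  (fun u => gauss_bounded u s0) iF.
have it1' : P.-integrable setT
    (EFin \o (fun w => tau (F w) * - gauss1 s (x - F w))).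
  by apply: eq_integrable (integrable_fN it1) => // w _; rewrite /= mulrN.
have : ('E_P[fun w => (F w * g (F w))%R] =
    'E_P[fun w => (tau (F w) * - gauss1 s (x - F w))%R])%E.
  have := stein g; rewrite g'E; apply => //.
  move=> y; apply: (@continuous_comp _ _ _ (fun y => x - y)
    (fun u => - gauss1 s u)).
    by apply: continuous_fB => //; exact: continuous_fC.
  by apply: continuousN; exact: continuous_gauss1.
rewrite unlock => /(congr1 fine); rewrite -!/(Rintegral _ _ _) => ->.
transitivity (\int[P]_w (-1 * (tau (F w) * gauss1 s (x - F w)))).
  by apply: eq_Rintegral => w _; ring.
by rewrite RintegralZl// mulN1r.
Qed.

Variable t : R.
Hypothesis t01 : 0 < t < 1.
Let s : R := t^-1 - 1.

Let t0 : 0 < t. Proof. by case/andP: t01. Qed.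

Let s0 : 0 < s.
Proof. by rewrite subr_gt0 invf_gt1//; case/andP: t01. Qed.

Let sqrt_t0 : 0 < Num.sqrt t. Proof. by rewrite sqrtr_gt0. Qed.

Let interpolationE w : interpolation F Z t w = Num.sqrt t * noised F Z s w.
Proof.
rewrite /interpolation /noised mulrDr mulrA -sqrtrM ?(ltW t0)//.
by congr (_ + Num.sqrt _ * _); rewrite /s mulrBr mulfV ?gt_eqF// mulr1.
Qed.

Let noisedE w : noised F Z s w = interpolation F Z t w / Num.sqrt t.
Proof. by rewrite interpolationE mulrC mulKf// gt_eqF. Qed.

Let mY : measurable_fun setT (interpolation F Z t).
Proof.
rewrite (_ : interpolation F Z t = fun w => Num.sqrt t * noised F Z s w).
  by apply: measurable_funM => //; exact: measurable_noised.
exact/funext/interpolationE.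
Qed.

Let q0 x : 0 < smooth P F s x. Proof. exact: smooth_gt0. Qed.

Let mscore : measurable_fun setT (score P F s).
Proof. exact: measurable_score. Qed.

Let iscore : leb.-integrable setT
  (fun x => (score P F s x * smooth P F s x)%:E).
Proof. exact: integrable_score. Qed.

(** F_t and G_s are proportional and so generate the same sigma-algebra; events transfer by
    rescaling [B]. *)
Lemma is_cond_expectation_score :
  is_cond_expectation P (fun w => Z w * (1 - tau (F w)))
    (interpolation F Z t) (fun w => score P F s (noised F Z s w)).
Proof.
have [mtau itau _] := F_tau.
split.
- move=> _ B mB; rewrite setTI.
  exists ((fun y => score P F s (y / Num.sqrt t)) @^-1` B).
    rewrite -[X in measurable X]setTI; apply: measurableT_comp => //.
    exact: measurable_funM.
  by rewrite setTI; apply/seteqP; split => w /=; rewrite noisedE.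
- apply: integrable_noised_score => //.
- move=> A [B mB <-]; rewrite setTI.
  have -> : interpolation F Z t @^-1` B =
      noised F Z s @^-1` ((fun y => Num.sqrt t * y) @^-1` B).
    by apply/seteqP; split => w /=; rewrite interpolationE.
  apply/esym; apply: noised_cond_integral => //.
    by move=> x; exact: stein_gauss.
  by rewrite -[X in measurable X]setTI; exact: measurable_funM.
Qed.

Lemma expectation_cond_sqr_noised :
  ('E_P[fun w => (cond_expectation P (fun w' => Z w' * (1 - tau (F w')))
      (interpolation F Z t) w ^+ 2)%R] =
   (s * (1 + s) * ((1 + s) * fisher P F s - 1))%:E)%E.
Proof.
rewrite (expectation_cond_sqr mY is_cond_expectation_score).
have iq := integrable_smooth P mF s0.
have i2 := integrable_score_sqr mF iF F1 iF2 F2 s0.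
have mq := integrable_measurable iq.
have q0' x : 0 <= smooth P F s x by rewrite ltW.
have m2 : measurable_fun setT (fun x => score P F s x ^+ 2).
  exact: measurable_funX.
have mn := measurable_noised F Z s.
have law := law_noised Z_normal FZ_indep s0.
rewrite (integral_law mn mq q0' law m2 (integrable_law mn mq q0' law m2 i2)).
by rewrite -EFin_Rintegral// Rintegral_score_sqr.
Qed.

End cond_expectation_noised.

(** * The limit of small noise *)

Section dominated.
Context d (T : measurableType d) (R : realType).
Variable mu : {measure set T -> \bar R}.

Lemma cvg_Rintegral (f_ : nat -> T -> R) (f G : T -> R) :
  (forall n, measurable_fun setT (f_ n)) -> measurable_fun setT f ->
  {ae mu, forall x, f_ n x @[n --> \oo] --> f x} ->
  (forall n x, `|f_ n x| <= G x) -> mu.-integrable setT (EFin \o G) ->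
  \int[mu]_x f_ n x @[n --> \oo] --> \int[mu]_x f x.
Proof.
move=> mf_ mf ff fG iG.
have mE n : measurable_fun setT (EFin \o f_ n) by exact/measurable_EFinP.
have mEf : measurable_fun setT (EFin \o f) by exact/measurable_EFinP.
have ffE : {ae mu, forall x, setT x -> (EFin (f_ n x) @[n --> \oo] --> EFin (f x))%E}.
  by apply: filterS ff => x fx _; exact: cvg_EFin (nearW _ _) fx.
have fGE : {ae mu, forall x n, setT x -> (`|EFin (f_ n x)| <= EFin (G x))%E}.
  by apply: aeW => x n _; rewrite lee_fin.
have [if_ _ H] := dominated_convergence measurableT mE mEf ffE iG fGE.
apply: fine_cvg; rewrite fineK; first exact: H.
exact: integrable_fin_num.
Qed.

Lemma fatou_le (f_ : nat -> T -> R) (f : T -> R) (L : \bar R) :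
  (forall n, measurable_fun setT (f_ n)) -> (forall n x, 0 <= f_ n x) ->
  (forall x, f_ n x @[n --> \oo] --> f x) ->
  (forall n, (\int[mu]_x (f_ n x)%:E <= L)%E) ->
  (\int[mu]_x (f x)%:E <= L)%E.
Proof.
move=> mf_ f0 ff fL.
have mE n : measurable_fun setT (EFin \o f_ n) by exact/measurable_EFinP.
have := @fatou _ _ _ mu setT measurableT (fun n => EFin \o f_ n) mE
  (fun n x _ => f0 n x).
rewrite (_ : (fun _ => limn_einf _) = EFin \o f); last first.
  apply/funext => x; apply: (cvg_limn_einf_sup _).1.
  exact: cvg_EFin (nearW _ _) (ff x).
move=> /le_trans; apply.
rewrite limn_einf_lim; apply: lime_le; first exact: is_cvg_einfs.
apply: nearW => n; apply: le_trans (fL n).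
by apply: ereal_inf_lbound; exists n => /=.
Qed.

End dominated.

Section continuous_approximation.
Context (R : realType) (g : R -> R) (M : R).
Local Notation leb := (@lebesgue_measure R).
Hypothesis mg : measurable_fun setT g.
Hypothesis gM : forall x, `|g x| <= M.
Hypothesis ig : leb.-integrable setT (EFin \o g).

Let G x := \int[leb]_(t in `]-oo, x]) g t.

Let igS (A : set R) : measurable A -> leb.-integrable A (EFin \o g).
Proof. by move=> mA; apply: integrableS ig. Qed.

Let G_lipschitz x y : x <= y -> `|G y - G x| <= M * (y - x).
Proof.
move=> xy; rewrite /G (@Rintegral_itvB _ g -oo%O (BRight y) x)//; last first.
  exact: igS.
apply: le_trans (le_normr_Rintegral _ (igS _)) _ => //.
have E : \int[leb]_(t in `]x, y]) M = M * (y - x).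
  rewrite Rintegral_cst//= lebesgue_measure_itv/= lte_fin.
  by move: xy; rewrite le_eqVlt => /predU1P[->|->]; rewrite ?ltxx ?subrr.
rewrite -E; apply: le_Rintegral => //.
- by apply: integrable_norm; exact: igS.
- apply: measurable_bounded_integrable => //.
  + by rewrite /= lebesgue_measure_itv/=; case: ifP => _; rewrite ltry.
  + exact: bounded_cst.
Qed.

Let G_continuous : continuous G.
Proof.
move=> x; apply/cvgrPdist_le => e e0.
have M0 : 0 <= M by rewrite (le_trans _ (gM 0)).
have M1 : 0 < M + 1 by rewrite ltr_wpDl.
near=> y.
have : `|G x - G y| <= M * `|x - y|.
  have [xy|/ltW yx] := leP x y.
    by rewrite distrC (le_trans (G_lipschitz xy))// distrC ger0_norm// subr_ge0.
  by rewrite (le_trans (G_lipschitz yx))// ger0_norm// subr_ge0.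
move=> /le_trans; apply.
have : `|x - y| <= e / (M + 1).
  by near: y; apply: cvgr_dist_le; rewrite ?divr_gt0//; exact: cvg_id.
rewrite ler_pdivlMr// mulrC mulrDl mul1r => H.
by rewrite (le_trans _ H)// lerDl.
Unshelve. all: by end_near. Qed.

(** Lebesgue differentiation: the averages of [g] over [x, x + 1 / (n + 1)], difference quotients of
    the Lipschitz primitive [G], are continuous, keep the bound [M] and converge almost
    everywhere. *)
Lemma continuous_approximation : exists g_ : nat -> R -> R,
  [/\ forall n, continuous (g_ n), forall n x, `|g_ n x| <= M &
    {ae leb, forall x, g_ n x @[n --> \oo] --> g x}].
Proof.
pose h n : R := n.+1%:R^-1.
have h0 n : 0 < h n by rewrite invr_gt0.
exists (fun n x => (h n)^-1 * (G (h n + x) - G x)); split.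
- move=> n x.
  apply: (@continuous_fM _ (fun=> (h n)^-1) (fun x => G (h n + x) - G x) x).
    exact: continuous_fC.
  apply: continuous_fB; last exact: G_continuous.
  apply: (@continuous_comp _ _ _ (fun x => h n + x) G); last exact: G_continuous.
  by apply: continuous_fD => //; exact: continuous_fC.
- move=> n x; rewrite normrM ger0_norm ?invr_ge0 ?(ltW (h0 n))//.
  rewrite mulrC ler_pdivrMr//.
  have := @G_lipschitz x (h n + x); rewrite lerDr (ltW (h0 n)) => /(_ isT).
  by rewrite addrK.
have iy y : leb.-integrable `]-oo, y] (EFin \o g) by exact: igS.
have gloc : locally_integrable [set: R] g.
  exact: open_integrable_locally openT ig.
have := FTC1Ny iy gloc.
apply: filterS; first exact: (ae_filter_ringOfSetsType leb).
move=> x [dG G'x].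
have /cvg_ex[/= l] := dG; under eq_fun do rewrite scaler1; move=> Gl.
have -> : g x = l by rewrite -G'x; exact/cvg_lim.
move: Gl => /cvgr_dnbhsP/(_ h) H.
have : (forall n, h n != 0) /\ h n @[n --> \oo] --> 0.
  by split=> [n|]; [rewrite gt_eqF|exact: cvg_harmonic].
exact: H.
Qed.

End continuous_approximation.

Section small_noise.
Context (R : realType) d (T : measurableType d) (P : probability T R).
Variables (F Z : {RV P >-> R}) (f : R -> R).
Hypothesis Ff : has_density F f.
Hypothesis Z_normal : is_normal Z 0 1.
Hypothesis FZ_indep : independent_RVs F Z.
Hypothesis iF : P.-integrable setT (EFin \o (F : T -> R)).
Hypothesis F1 : \int[P]_w F w = 0.
Hypothesis iF2 : P.-integrable setT (fun w => (F w ^+ 2)%:E).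
Hypothesis F2 : \int[P]_w (F w ^+ 2) = 1.
Local Notation leb := (@lebesgue_measure R).
Local Notation phi := (@gauss R 1).

Let mF : measurable_fun setT (F : T -> R). Proof. exact: measurable_funP. Qed.

Let mf : measurable_fun setT f. Proof. by have [] := Ff. Qed.

Let f0 x : 0 <= f x. Proof. by have [_ ->] := Ff. Qed.

Let law (A : set R) : measurable A ->
  P (F @^-1` A) = (\int[leb]_(x in A) (f x)%:E)%E.
Proof. by have [_ _] := Ff; apply. Qed.

Let if_ : leb.-integrable setT (EFin \o f).
Proof. exact: integrable_law_density mf f0 law. Qed.

Let iphi : leb.-integrable setT (EFin \o phi).
Proof. exact: integrable_gauss. Qed.

Let mphi : measurable_fun setT phi. Proof. exact: measurable_gauss. Qed.

Let bounded_mul (g k : R -> R) (M : R) : measurable_fun setT g ->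
  (forall x, `|g x| <= M) -> leb.-integrable setT (EFin \o k) ->
  leb.-integrable setT (fun x => (g x * k x)%:E).
Proof.
move=> mg gM ik.
have mg' : measurable_fun setT (g : measurableTypeR R -> R) by exact: mg.
have := integrable_bounded_mul mg' gM ik.
by apply: eq_integrable => // x _; rewrite mulrC.
Qed.

Let expR_bounded (g : R -> R) (M : R) : (forall x, `|g x| <= M) ->
  forall x, `|expR (g x)| <= expR M.
Proof.
move=> gM x; rewrite ger0_norm ?expR_ge0// ler_expR.
by rewrite (le_trans (ler_norm _)).
Qed.

Variables (s_ : nat -> R) (L : R).
Hypothesis s_gt0 : forall n, 0 < s_ n.
Hypothesis s_cvg0 : s_ n @[n --> \oo] --> 0.
Hypothesis entropyL : forall n,
  entropy P F (s_ n) + (ln (2 * pi) / 2 + 2^-1) <= L.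

(** [entropy_ge] with h = g + ln phi, before the limit in s. Continuity of [g] is what lets s tend
    to 0, since G_s tends to [F] pointwise on the sample space. *)
Let test_continuous (g : R -> R) (M : R) : continuous g ->
  (forall x, `|g x| <= M) ->
  1 + \int[leb]_x (g x * f x) - \int[leb]_x (expR (g x) * phi x) <= L.
Proof.
move=> cg gM; have mg : measurable_fun setT g by exact: continuous_measurable_fun.
have M0 : 0 <= M by rewrite (le_trans _ (gM 0)).
have [C [C0 HC]] := lgauss_bound (@ltr01 R).
have mPg (X : T -> R) : measurable_fun setT X ->
    measurable_fun setT (fun w => g (X w)) by move=> mX; exact: measurableT_comp.
(* The term s / 2 is the excess of the second moment 1 + s of G_s in the mean of ln phi. *)
have cvg1 : 1 + \int[P]_w g (noised F Z (s_ n) w) - s_ n / 2 -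
    \int[leb]_x (expR (g x) * phi x) @[n --> \oo] -->
    1 + \int[leb]_x (g x * f x) - 0 / 2 - \int[leb]_x (expR (g x) * phi x).
  apply: cvgB; last exact: cvg_cst.
  apply: cvgB; last by apply: cvgM; [exact: s_cvg0|exact: cvg_cst].
  apply: cvgD; first exact: cvg_cst.
  have -> : \int[leb]_x (g x * f x) = \int[P]_w g (F w).
    congr fine; apply/esym/(integral_law mF mf f0 law mg).
    by apply: (@integrable_bounded _ _ _ P _ M) => //; exact: mPg.
  apply: (@cvg_Rintegral _ _ _ P _ _ (cst M)) => //.
  - by move=> n; apply: mPg; exact: measurable_noised.
  - exact: mPg.
  - apply: aeW => w; apply: continuous_cvg; first exact: cg.
    rewrite -[X in _ --> X]addr0; apply: cvgD; first exact: cvg_cst.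
    rewrite -[X in _ --> X](mul0r (Z w)); apply: cvgM; last exact: cvg_cst.
    rewrite -(@sqrtr0 R); apply: continuous_cvg; first exact: sqrt_continuous.
    exact: s_cvg0.
  - exact: finite_measure_integrable_cst.
move: cvg1; rewrite mul0r subr0 => cvg1.
apply: (ler_cvg_to cvg1 (cvg_cst L)); apply: nearW => n /=.
have s0 := s_gt0 n.
have h_bound x : `|g x + lgauss 1 x| <= (M + C) * (1 + x ^+ 2).
  rewrite (le_trans (ler_normD _ _))// mulrDl lerD//.
  by rewrite (le_trans (gM x))// ler_peMr// lerDl sqr_ge0.
have mh : measurable_fun setT (fun x => g x + lgauss 1 x).
  by apply: measurable_funD => //; exact: measurable_lgauss.
have hE : (fun x => (expR (g x + lgauss 1 x))%:E) =
    (fun x => (expR (g x) * phi x)%:E).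
  by apply/funext => x; rewrite expRD.
have ie : leb.-integrable setT (fun x => (expR (g x + lgauss 1 x))%:E).
  rewrite hE; apply: bounded_mul (expR_bounded gM) iphi.
  exact: measurableT_comp.
have := entropy_ge mF iF F1 iF2 F2 s0 mh h_bound ie.
have iq := integrable_smooth P mF s0.
have igq := bounded_mul mg gM iq.
have ilq : leb.-integrable setT (fun x => (lgauss 1 x * smooth P F (s_ n) x)%:E).
  apply: (@le_integrable_f _ _ _ leb _
    (fun x => C * (1 + x ^+ 2) * smooth P F (s_ n) x)).
  - apply: measurable_funM; first exact: measurable_lgauss.
    exact: integrable_measurable iq.
  - move=> x; have q0 := smooth_gt0 mF iF F1 iF2 F2 x s0.
    by rewrite normrM (gtr0_norm q0) ler_pM2r.
  - exact: integrable_quadratic_smooth.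
have -> : \int[leb]_x expR (g x + lgauss 1 x) =
    \int[leb]_x (expR (g x) * phi x).
  by apply: eq_Rintegral => x _; rewrite expRD.
have -> : \int[leb]_x ((g x + lgauss 1 x) * smooth P F (s_ n) x) =
    \int[leb]_x (g x * smooth P F (s_ n) x) +
    (- (ln (2 * pi * 1) / 2) - (1 + s_ n) / (2 * 1)).
  rewrite -(Rintegral_lgauss_smooth mF iF F1 iF2 F2)// -RintegralD//.
  by apply: eq_Rintegral => x _; rewrite mulrDl.
have -> : \int[leb]_x (g x * smooth P F (s_ n) x) =
    \int[P]_w g (noised F Z (s_ n) w).
  congr fine; apply/esym/(integral_law _ _ _ _ mg).
  - exact: measurable_noised.
  - exact: integrable_measurable iq.
  - by move=> x; rewrite ltW//; exact: smooth_gt0.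
  - exact: law_noised.
  - apply: (@integrable_bounded _ _ _ P _ M) => //.
    by apply: mPg; exact: measurable_noised.
have := entropyL n; rewrite !mulr1 => H1 H2.
lra.
Qed.

(** Almost everywhere convergence of the approximants suffices because the law of [F] is integrated
    through its density; M * f and e^M * phi dominate. *)
Let test_measurable (g : R -> R) (M : R) : measurable_fun setT g ->
  (forall x, `|g x| <= M) -> leb.-integrable setT (EFin \o g) ->
  1 + \int[leb]_x (g x * f x) - \int[leb]_x (expR (g x) * phi x) <= L.
Proof.
move=> mg gM ig; have [g_ [cg_ g_M gg]] := continuous_approximation gM ig.
have mg_ n : measurable_fun setT (g_ n) by exact: continuous_measurable_fun.
have mM (k : R -> R) : measurable_fun setT k ->
    measurable_fun setT (fun x => k x * f x) by move=> mk; exact: measurable_funM.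
have mE (k : R -> R) : measurable_fun setT k ->
    measurable_fun setT (fun x => expR (k x) * phi x).
  by move=> mk; apply: measurable_funM => //; exact: measurableT_comp.
have aeF := ae_filter_ringOfSetsType leb.
have cvg1 : 1 + \int[leb]_x (g_ n x * f x) -
    \int[leb]_x (expR (g_ n x) * phi x) @[n --> \oo] -->
    1 + \int[leb]_x (g x * f x) - \int[leb]_x (expR (g x) * phi x).
  apply: cvgB.
    apply: cvgD; first exact: cvg_cst.
    apply: (@cvg_Rintegral _ _ _ leb _ _ (fun x => M * f x)).
    - by move=> n; exact: (mM _ (mg_ n)).
    - exact: (mM _ mg).
    - apply: filterS gg => x gx; apply: cvgM; [exact: gx|exact: cvg_cst].
    - by move=> n x; rewrite normrM (ger0_norm (f0 x)) ler_wpM2r.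
    - exact: integrable_fZ.
  apply: (@cvg_Rintegral _ _ _ leb _ _ (fun x => expR M * phi x)).
  - by move=> n; exact: (mE _ (mg_ n)).
  - exact: (mE _ mg).
  - apply: filterS gg => x gx; apply: cvgM; last exact: cvg_cst.
    by apply: continuous_cvg; [exact: continuous_expR|exact: gx].
  - move=> n x; rewrite normrM (ger0_norm (gauss_ge0 _ _)).
    rewrite ler_wpM2r ?gauss_ge0//.
    exact: (expR_bounded (g_M n)).
  - exact: integrable_fZ.
apply: (ler_cvg_to cvg1 (cvg_cst L)); apply: nearW => n /=.
exact: test_continuous (cg_ n) (g_M n).
Qed.

Let h x : R := f x / phi x.

(** Clamping [h] between e^-m and e^m keeps its logarithm in [-m, m]. *)
Let c m x : R := Num.min (expR m%:R) (Num.max (h x) (expR (- m%:R))).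

(** The spatial cut-off makes this bounded test function integrable, as [continuous_approximation]
    requires. *)
Let g m x : R := \1_`[- m%:R, m%:R] x * ln (c m x).

(* The integrand of the tangent bound at the truncation [c m] of the density
   ratio [h]. *)
Let psi_ m x : R := g m x * f x - expR (g m x) * phi x + phi x.

(** The relative entropy integrand plus phi - f, which has integral 0 and makes it nonnegative,
    ready for Fatou's lemma. *)
Let psi x : R := f x * ln (h x) - f x + phi x.

Let phi_gt0 x : 0 < phi x. Proof. exact: gauss_gt0. Qed.

Let h_ge0 x : 0 <= h x. Proof. by rewrite divr_ge0// ltW. Qed.

Let fE x : f x = phi x * h x.
Proof. by rewrite /h mulrC divfK// gt_eqF. Qed.

Let c_ge m x : expR (- m%:R) <= c m x.
Proof.
rewrite /c le_min le_max lexx orbT andbT ler_expR.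
by rewrite (@le_trans _ _ 0)// oppr_le0.
Qed.

Let c_le m x : c m x <= expR m%:R.
Proof. by rewrite /c ge_min lexx. Qed.

Let c_gt0 m x : 0 < c m x.
Proof. by apply: lt_le_trans (c_ge m x); exact: expR_gt0. Qed.

Let ln_c_bound m x : `|ln (c m x)| <= m%:R.
Proof.
rewrite ler_norml; apply/andP; split.
- by rewrite -ler_expR lnK ?posrE.
- by rewrite -ler_expR lnK ?posrE.
Qed.

Let mh : measurable_fun setT h.
Proof.
apply: measurable_funM => //; apply: continuous_measurable_fun => x.
by apply: continuous_fV; [rewrite gt_eqF|exact: continuous_gauss].
Qed.

Let mg m : measurable_fun setT (g m).
Proof.
apply: measurable_funM; first exact: measurable_indic.
apply: measurableT_comp => //.
by apply: measurable_minr => //; apply: measurable_maxr.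
Qed.

Let g_bound m x : `|g m x| <= m%:R.
Proof.
rewrite normrM -[leRHS]mul1r; apply: ler_pM => //.
by rewrite indicE; case: (_ \in _); rewrite ?normr1 ?normr0.
Qed.

Let ig m : leb.-integrable setT (EFin \o g m).
Proof.
apply: (@le_integrable_f _ _ _ leb _ (fun x => m%:R * \1_`[- m%:R, m%:R] x)).
- exact: mg.
- move=> x; rewrite normrM mulrC ler_pM//.
  by rewrite ger0_norm.
- by apply: integrable_fZ; exact: integrable_indic_itv.
Qed.

(** Split as (c ln c - c + 1) + (h - c) ln c. The first term is nonnegative by convexity; clamping
    moves [h] towards 1, so h - c and ln c never have opposite signs. *)
Let psi_ge0_aux m x : 0 <= h x * ln (c m x) - c m x + 1.
Proof.
have := gibbs_tangent (ltW (c_gt0 m x)) (@ltr01 R); rewrite ln1 addr0 mulr1 => H.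
suff : 0 <= (h x - c m x) * ln (c m x) by rewrite mulrBl; lra.
have [h1|h1] := leP 1 (h x).
  have c1 : 1 <= c m x.
    rewrite /c le_min le_max h1 andbT -[leLHS]expR0 ler_expR.
    by [].
  have ch : c m x <= h x.
    rewrite /c ge_min; apply/orP; right; rewrite ge_max lexx/=.
    by rewrite (le_trans _ h1)// -[leRHS]expR0 ler_expR oppr_le0.
  by rewrite mulr_ge0 ?subr_ge0// ln_ge0.
have c1 : c m x <= 1.
  rewrite /c ge_min; apply/orP; right; rewrite ge_max (ltW h1)/=.
  by rewrite -[leRHS]expR0 ler_expR oppr_le0.
have ch : h x <= c m x.
  rewrite /c le_min le_max lexx/= andbT (le_trans (ltW h1))//.
  by rewrite -[leLHS]expR0 ler_expR.
by rewrite mulr_le0 ?subr_le0// ln_le0.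
Qed.

Let psi_E m x :
  psi_ m x = \1_`[- m%:R, m%:R] x * (phi x * (h x * ln (c m x) - c m x + 1)).
Proof.
rewrite /psi_ /g fE indicE; case: (_ \in _).
  by rewrite !mul1r lnK ?posrE//; ring.
by rewrite !mul0r expR0; ring.
Qed.

Let psi_ge0 m x : 0 <= psi_ m x.
Proof.
rewrite psi_E; apply: mulr_ge0; first by rewrite indicE; case: (_ \in _).
by rewrite mulr_ge0// ltW.
Qed.

Let psi_cvg x : psi_ m x @[m --> \oo] --> psi x.
Proof.
have E : psi x = 1 * (phi x * (h x * ln (h x) - h x + 1)).
  by rewrite /psi [in RHS]mulrDr mulrBr [in RHS]mulrA -fE; ring.
rewrite E (_ : psi_ ^~ x = fun m => \1_`[- m%:R, m%:R] x *
  (phi x * (h x * ln (c m x) - c m x + 1))); last first.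
  by apply/funext => m; rewrite psi_E.
apply: cvgM.
  apply: cvg_near_cst; near=> m.
  rewrite indicE mem_set//= in_itv/= -ler_norml.
  by near: m; exact: nbhs_infty_ger.
apply: cvgM; first exact: cvg_cst.
apply: cvgD; last exact: cvg_cst.
(* If h x = 0 the clamp is e^-m, never 0, but its logarithm carries the factor 0; if h x > 0 the
   clamp is eventually inactive. *)
have [h0|hn0] := eqVneq (h x) 0.
  rewrite h0 !mul0r (_ : (fun m => _) = (fun m => 0 - expR (- m%:R))).
    by apply: cvgB; [exact: cvg_cst|exact: cvgn_expR].
  apply/funext => m; rewrite mul0r; congr (_ - _).
  rewrite /c h0 max_r ?expR_ge0// min_r// ler_expR.
  by rewrite (@le_trans _ _ 0)// oppr_le0.
have hp : 0 < h x by rewrite lt_neqAle eq_sym hn0 h_ge0.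
apply: cvg_near_cst; near=> m.
suff -> : c m x = h x by [].
have H : `|ln (h x)| <= m%:R by near: m; exact: nbhs_infty_ger.
move: H; rewrite ler_norml => /andP[H1 H2].
rewrite /c max_l; last by rewrite -[leRHS](lnK (x := h x)) ?posrE// ler_expR.
by rewrite min_r// -[leLHS](lnK (x := h x)) ?posrE// ler_expR.
Unshelve. all: by end_near. Qed.

Let psi_pos x : 0 <= psi x.
Proof.
have := gibbs_tangent (h_ge0 x) (@ltr01 R); rewrite ln1 addr0 mulr1 => H.
rewrite /psi (_ : _ + _ = phi x * (h x * ln (h x) - h x + 1)).
  by apply: mulr_ge0; [exact: ltW|lra].
by rewrite [in RHS]mulrDr mulrBr [in RHS]mulrA -fE; ring.
Qed.

Let mpsi : measurable_fun setT psi.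
Proof.
apply: measurable_funD => //; apply: measurable_funB => //.
by apply: measurable_funM => //; exact: measurableT_comp.
Qed.

Let psi_m_le m : (\int[leb]_x (psi_ m x)%:E <= L%:E)%E.
Proof.
have i1 := bounded_mul (mg m) (g_bound m) if_.
have i2 : leb.-integrable setT (fun x => (expR (g m x) * phi x)%:E).
  apply: bounded_mul (expR_bounded (g_bound m)) iphi.
  exact: measurableT_comp (mg m).
have i3 := integrable_fB i1 i2.
have i4 := integrable_fD i3 iphi.
rewrite -EFin_Rintegral// lee_fin RintegralD// RintegralB// Rintegral_gauss//.
by have := test_measurable (mg m) (g_bound m) (ig m); lra.
Qed.

Let relative_entropyE :
  (relative_entropy_normal f = \int[leb]_x (f x * ln (h x))%:E)%E.
Proof.
apply: eq_integral => x _; congr (_ * ln (_ / _))%:E.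
by rewrite gauss_normal_pdf// sqrtr1.
Qed.

Lemma relative_entropy_le : (relative_entropy_normal f <= L%:E)%E.
Proof.
have mpsi_ m : measurable_fun setT (psi_ m).
  apply: measurable_funD => //; apply: measurable_funB.
    by apply: measurable_funM => //; exact: mg.
  apply: measurable_funM => //; apply: measurableT_comp => //; exact: mg.
have psiL := @fatou_le _ _ _ leb psi_ psi _ mpsi_ psi_ge0 psi_cvg psi_m_le.
have ipsi : leb.-integrable setT (EFin \o psi).
  apply/integrableP; split; first exact/measurable_EFinP.
  under eq_integral do rewrite /= ger0_norm//.
  exact: le_lt_trans psiL (ltry L).
rewrite relative_entropyE; apply: (le_trans _ psiL).
have -> : (\int[leb]_x (f x * ln (h x))%:E =
    \int[leb]_x (psi x + f x - phi x)%:E)%E.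
  by apply: eq_integral => x _; congr EFin; rewrite /psi; ring.
have i1 := integrable_fD ipsi if_; have i2 := integrable_fB i1 iphi.
rewrite -!EFin_Rintegral// lee_fin RintegralB// RintegralD// Rintegral_gauss//.
by rewrite (Rintegral_law_density law) addrK.
Qed.

Let u x : R := f x * ln (h x).

Let mu_ : measurable_fun setT u.
Proof. by apply: measurable_funM => //; exact: measurableT_comp. Qed.

Let mEu : measurable_fun setT (EFin \o u).
Proof. exact/measurable_EFinP. Qed.

(** psi >= 0 and f >= 0 give u >= - phi, so the negative part has integral at most 1. *)
Let neg_fin : (\int[leb]_x (EFin \o u)^\- x)%E \is a fin_num.
Proof.
rewrite ge0_fin_numE; last exact: integral_ge0.
apply: (@le_lt_trans _ _ (\int[leb]_x (phi x)%:E)%E); last first.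
  by rewrite integral_gauss// ltry.
apply: ge0_le_integral => //.
- exact: measurable_funeneg.
- exact: measurable_int iphi.
- move=> x _; rewrite funenegE -EFinN -EFin_max lee_fin ge_max gauss_ge0 andbT.
  by have := psi_pos x; have := f0 x; rewrite /psi /u; lra.
Qed.

Lemma relative_entropy_neqNy : (relative_entropy_normal f != -oo)%E.
Proof.
rewrite relative_entropyE [X in X != _]integralE -(fineK neg_fin).
have : (0 <= \int[leb]_x (EFin \o u)^\+ x)%E by exact: integral_ge0.
by case: (\int[leb]_x (EFin \o u)^\+ x)%E.
Qed.

Let integrable_u (D : R) : relative_entropy_normal f = D%:E ->
  leb.-integrable setT (EFin \o u).
Proof.
move=> relD; have neg_lt : (\int[leb]_x (EFin \o u)^\- x < +oo)%E.
  by rewrite -ge0_fin_numE//; exact: integral_ge0.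
have pos_lt : (\int[leb]_x (EFin \o u)^\+ x < +oo)%E.
  move: relD; rewrite relative_entropyE [X in X = _]integralE -(fineK neg_fin).
  by rewrite ltey => relD; apply/eqP => pos_oo; rewrite pos_oo in relD.
apply/integrableP; split => //.
under eq_integral do rewrite -/((abse \o (EFin \o u)) _) fune_abse.
rewrite ge0_integralD//; first exact: lte_add_pinfty.
- exact: measurable_funepos.
- exact: measurable_funeneg.
Qed.

Let integrable_sqr_density : leb.-integrable setT (fun x => (x ^+ 2 * f x)%:E).
Proof.
apply/integrableP; split.
  by apply/measurable_EFinP; apply: measurable_funM => //; exact: measurable_funX.
under eq_integral => x _.
  rewrite /= ger0_norm; last by apply: mulr_ge0 => //; exact: sqr_ge0.
  over.
rewrite -(integral_law mF mf f0 law (k := fun x => x ^+ 2))//.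
by rewrite -EFin_Rintegral// ltry.
Qed.

(** The cross-entropy integrand f ln phi, by which f ln f differs from [u]. *)
Let k x : R := lgauss 1 x * f x.

Let ik : leb.-integrable setT (EFin \o k).
Proof.
have [C [_ HC]] := lgauss_bound (@ltr01 R).
apply: (@le_integrable_f _ _ _ leb _ (fun x => C * (f x + x ^+ 2 * f x))).
- by apply: measurable_funM => //; exact: measurable_lgauss.
- move=> x; rewrite normrM (ger0_norm (f0 x)).
  rewrite (_ : C * _ = C * (1 + x ^+ 2) * f x); last by ring.
  by rewrite ler_wpM2r.
- by apply: integrable_fZ; exact: integrable_fD.
Qed.

Let Rintegral_k : \int[leb]_x k x = - (ln (2 * pi) / 2) - 2^-1.
Proof.
have iA : P.-integrable setT
    (EFin \o (fun w => 2^-1 * F w ^+ 2)) by exact: integrable_fZ.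
have iB : P.-integrable setT (EFin \o (cst (- (ln (2 * pi) / 2)) : T -> R)).
  exact: finite_measure_integrable_cst.
have E x : lgauss 1 x = - (ln (2 * pi) / 2) - 2^-1 * x ^+ 2.
  by rewrite /lgauss !mulr1 [x ^+ 2 / 2]mulrC.
have il : P.-integrable setT (fun w => (lgauss 1 (F w))%:E).
  by apply: eq_integrable (integrable_fB iB iA) => // w _; rewrite /= E.
transitivity (\int[P]_w lgauss 1 (F w)).
  congr fine.
  exact/esym/(integral_law mF mf f0 law (measurable_lgauss 1) il).
under eq_Rintegral do rewrite E.
by rewrite RintegralB// RintegralZl// Rintegral_cst_prob F2 mulr1.
Qed.

Let fln x : R := f x * ln (f x).

Let flnE x : fln x = u x + k x.
Proof.
rewrite /fln /u /k; have [->|fn0] := eqVneq (f x) 0.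
  by rewrite !mul0r mulr0 addr0.
have fp : 0 < f x by rewrite lt_neqAle eq_sym fn0 f0.
by rewrite /h ln_div ?posrE// ln_gauss; ring.
Qed.

(** Convolution lowers the convex functional r ln r. Finiteness of D(F || Z) makes f ln f
    integrable, so its convolution with the unit-mass kernel has the same integral and can be
    compared with q ln q pointwise. *)
Lemma entropy_le_relative (D s : R) : 0 < s ->
  relative_entropy_normal f = D%:E ->
  entropy P F s + (ln (2 * pi) / 2 + 2^-1) <= D.
Proof.
move=> s0 relD; have iu := integrable_u relD.
have ifln : leb.-integrable setT (EFin \o fln).
  by apply: eq_integrable (integrable_fD iu ik) => // x _; rewrite /= flnE.
have DE : D = \int[leb]_x u x.
  by rewrite /Rintegral -relative_entropyE relD.
have flnI : \int[leb]_x fln x = D - (ln (2 * pi) / 2 + 2^-1).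
  transitivity (\int[leb]_x (u x + k x)).
    by apply: eq_Rintegral => x _; exact: flnE.
  by rewrite RintegralD// -DE Rintegral_k; ring.
suff : entropy P F s <= \int[leb]_x fln x by rewrite flnI; lra.
have mid : measurable_fun setT (fun x : measurableTypeR R => x : R).
  exact: measurable_id.
have igs := integrable_gauss s0.
have iconv := integrable_conv mid ifln igs.
have <- : \int[leb]_x \int[leb]_y (fln y * gauss s (x - y)) = \int[leb]_x fln x.
  by rewrite (Rintegral_conv mid ifln igs) Rintegral_gauss// mulr1.
apply: le_Rintegral => //; first exact: integrable_entropy.
move=> x _; have q0 := smooth_gt0 mF iF F1 iF2 F2 x s0.
have grev y : gauss s (x - y) = gauss s (y - x).
  by rewrite /gauss /lgauss -sqrrN opprB.
have igx : leb.-integrable setT (EFin \o (fun y => gauss s (x - y))).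
  by apply: eq_integrable (integrable_shift x igs) => // y _; rewrite /= grev.
have mgx : measurable_fun setT (fun y : R => gauss s (x - y)).
  apply: measurableT_comp; first exact: measurable_gauss.
  exact: measurable_funB.
have gx_bound y : `|gauss s (x - y)| <= gauss s 0 by exact: gauss_bounded.
have mgx' : measurable_fun setT
    (fun y : measurableTypeR R => gauss s (x - y)) by exact: mgx.
have ifg := integrable_bounded_mul mgx' gx_bound if_.
have iflng := integrable_bounded_mul mgx' gx_bound ifln.
have qE : smooth P F s x = \int[leb]_y (f y * gauss s (x - y)).
  rewrite /smooth /Rintegral (integral_law mF mf f0 law mgx)//.
    by congr fine; apply: eq_integral => y _; rewrite mulrC.
  exact: integrable_gauss_rev.
set l := ln (smooth P F s x).
have iA : leb.-integrable setT (EFin \o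
    (fun y => (1 + l) * (f y * gauss s (x - y)))) by exact: integrable_fZ.
have iB : leb.-integrable setT (EFin \o
    (fun y => smooth P F s x * gauss s (x - y))) by exact: integrable_fZ.
(* The kernel averages [f] to q_s(x), so the tangent at q_s(x) averages to exactly q ln q. *)
have -> : smooth P F s x * l = \int[leb]_y ((1 + l) * (f y * gauss s (x - y)) -
    smooth P F s x * gauss s (x - y)).
  rewrite RintegralB// !RintegralZl// -qE.
  under eq_Rintegral do rewrite grev.
  by rewrite Rintegral_shift ?Rintegral_gauss//; [ring|exact: measurable_gauss].
apply: le_Rintegral => //; first exact: integrable_fB.
move=> y _; have := gibbs_tangent (f0 y) q0; rewrite -/l => H.
have := ler_wpM2r (gauss_ge0 s (x - y)) H.
by rewrite mulrBl [_ * (1 + l)]mulrC mulrA.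
Qed.

End small_noise.

(** * De Bruijn's identity *)

Section de_bruijn.
Context (R : realType) d (T : measurableType d) (P : probability T R).
Variables (F Z : {RV P >-> R}) (f tau : R -> R).
Hypothesis Ff : has_density F f.
Hypothesis F_tau : is_Stein_factor F tau.
Hypothesis Z_normal : is_normal Z 0 1.
Hypothesis FZ_indep : independent_RVs F Z.
Hypothesis iF : P.-integrable setT (EFin \o (F : T -> R)).
Hypothesis F1 : \int[P]_w F w = 0.
Hypothesis iF2 : P.-integrable setT (fun w => (F w ^+ 2)%:E).
Hypothesis F2 : \int[P]_w (F w ^+ 2) = 1.
Local Notation leb := (@lebesgue_measure R).
Implicit Types (s t a b : R).

Let mF : measurable_fun setT (F : T -> R). Proof. exact: measurable_funP. Qed.

Let sigma t : R := t^-1 - 1.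

Let sigma_gt0 t : 0 < t < 1 -> 0 < sigma t.
Proof. by move=> /andP[t0 t1]; rewrite subr_gt0 invf_gt1. Qed.

(* The relative entropy of [F_t], up to the change of variable
   [t = 1 / (1 + s)]. *)
Let H t : R := entropy P F (sigma t) - ln t / 2 + (ln (2 * pi) / 2 + 2^-1).

Let H' t : R := entropy' P F (sigma t) * - t ^- 2 - t^-1 / 2.

Let is_derive_H t : 0 < t < 1 -> is_derive t 1 H (H' t).
Proof.
move=> t01; have /andP[t0 _] := t01.
have tn0 : t != 0 by rewrite gt_eqF.
have Ds : is_derive t 1 sigma (- t ^- 2 * 1 - 0).
  exact: (is_derive_fB (is_derive_fV tn0 (is_derive_id t 1)) (is_derive_fC 1 t)).
apply: (is_derive_eq (is_derive_fD (is_derive_fB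
  (is_derive_comp Ds (is_derive_entropy mF iF F1 iF2 F2 (sigma_gt0 t01)))
  (is_derive_fM (is_derive1_ln t0) (is_derive_fC _ _))) (is_derive_fC _ _))).
by rewrite /H' subr0 mulr1 addr0 mulr0 addr0.
Qed.

Let continuous_H' t : 0 < t < 1 -> {for t, continuous H'}.
Proof.
move=> t01; have /andP[t0 _] := t01; have tn0 : t != 0 by rewrite gt_eqF.
have cV : {for t, continuous (fun t : R => t^-1)}.
  by apply: continuous_fV => //.
apply: continuous_fB; last first.
  by apply: continuous_fM => //; exact: continuous_fC.
apply: continuous_fM.
  apply: (@continuous_comp _ _ _ sigma (entropy' P F)).
    by apply: continuous_fB => //; exact: continuous_fC.
  exact: (continuous_entropy' mF iF F1 iF2 F2 (sigma_gt0 t01)).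
apply: continuousN; apply: continuous_fV; first by rewrite expf_neq0.
exact: continuous_fX.
Qed.

Let K t : \bar R := ((t / (1 - t))%R%:E *
  'E_P[fun w => (cond_expectation P (fun w' => Z w' * (1 - tau (F w')))
                   (interpolation F Z t) w ^+ 2)%R])%E.

Let K_ge0 t : 0 <= t <= 1 -> (0 <= K t)%E.
Proof.
move=> /andP[t0 t1]; rewrite /K mule_ge0//.
  by rewrite lee_fin divr_ge0// subr_ge0.
by apply: expectation_ge0 => w; exact: sqr_ge0.
Qed.

Let KE t : 0 < t < 1 -> K t = (2 * H' t)%:E.
Proof.
move=> t01; have /andP[t0 t1] := t01; have s0 := sigma_gt0 t01.
rewrite /K (expectation_cond_sqr_noised Z_normal FZ_indep F_tau iF F1 iF2 F2 t01).
rewrite -EFinM; congr EFin.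
rewrite /H' (entropy'_fisher mF iF F1 iF2 F2 s0) /sigma.
by field; rewrite !gt_eqF// subr_gt0.
Qed.

(** This amounts to the Cramer-Rao bound I >= t for the Fisher information; here it is read off the
    expected square in [K]. *)
Let H'_ge0 t : 0 < t < 1 -> 0 <= H' t.
Proof.
move=> t01; have /andP[/ltW t0 /ltW t1] := t01.
have := K_ge0 (t := t); rewrite t0 t1 => /(_ isT).
by rewrite KE// lee_fin pmulr_rge0.
Qed.

Let in01 t : t \in `]0, 1[ -> 0 < t < 1. Proof. by rewrite in_itv. Qed.

Let mH' : measurable_fun (`]0, 1[%classic : set R) H'.
Proof.
apply: open_continuous_measurable_fun => // t /[!inE] /in01.
exact: continuous_H'.
Qed.

Let X : \bar R := (\int[leb]_(t in `]0%R, 1%R[) (H' t)%:E)%E.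

Let integral_K : ((2^-1)%:E * \int[leb]_(t in `[0%R, 1%R]) K t = X)%E.
Proof.
have -> : (\int[leb]_(t in `[0%R, 1%R]) K t =
    \int[leb]_(t in `]0%R, 1%R[) (2 * H' t)%:E)%E.
  have -> : `]0, 1[%classic = `[0, 1]%classic `&` `]0, 1[%classic :> set R.
    by apply/esym/setIidr; exact: subset_itv_oo_cc.
  rewrite integral_mkcondr; apply: eq_integral => t /[!inE] /=.
  rewrite in_itv/= => /andP[t0 t1]; rewrite patchE.
  case: ifPn => [/[!inE]/= /in01 t01|/negP t01]; first exact: KE.
  (* [K] is 0 at both end points: t vanishes at 0, and at 1 the inverse of 0 is 0 by convention. *)
  have [->|t_neq0] := eqVneq t 0; first by rewrite /K mul0r mul0e.
  have [->|t_neq1] := eqVneq t 1; first by rewrite /K subrr invr0 mulr0 mul0e.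
  exfalso; apply: t01; rewrite inE/= in_itv/=.
  by rewrite !lt_neqAle t0 t1 eq_sym t_neq0 t_neq1.
under eq_integral do rewrite EFinM.
rewrite ge0_integralZl//=.
- by rewrite muleA -EFinM mulVf// mul1e.
exact/measurable_EFinP.
Qed.

Let itv_sub a b : 0 < a -> b < 1 -> `[a, b]%classic `<=` `]0, 1[%classic.
Proof.
move=> a0 b1 t /=; rewrite !in_itv/= => /andP[at_ tb].
by rewrite (lt_le_trans a0)//= (le_lt_trans tb).
Qed.

Let FTC_H a b : 0 < a -> a < b -> b < 1 ->
  (\int[leb]_(t in `[a, b]) (H' t)%:E = (H b - H a)%:E)%E.
Proof.
move=> a0 ab b1; apply: continuous_FTC2_itvcc => // t /(itv_sub a0 b1)/in01.
  exact: continuous_H'.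
exact: is_derive_H.
Qed.

Let H_increment_le a b : 0 < a -> a < b -> b < 1 -> ((H b - H a)%:E <= X)%E.
Proof.
move=> a0 ab b1; rewrite -FTC_H//; apply: ge0_subset_integral => //.
- exact/measurable_EFinP.
exact: itv_sub.
Qed.

(** Starting at 1 / 3 keeps e n < 1 - e m for all n and m, and puts e n in the range of
    [ln_onem_ge]. *)
Let e n : R := n.+3%:R^-1.

Let e_gt0 n : 0 < e n. Proof. by rewrite invr_gt0. Qed.

Let e_lt n m : e n < 1 - e m.
Proof.
have h k : e k <= 3^-1 by rewrite lef_pV2 ?posrE// ler_nat.
have := h n; have := h m; lra.
Qed.

(** Monotone convergence over the increasing intervals [e n, 1 - e n], on each of which the
    fundamental theorem of calculus applies. *)
Let cvg_X : ((H (1 - e n) - H (e n))%:E @[n --> \oo] --> X)%E.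
Proof.
pose E n : set R := `[e n, 1 - e n]%classic.
have E_sub n : E n `<=` `]0, 1[%classic.
  by apply: itv_sub => //; rewrite ltrBlDr ltrDl.
have -> : X = (\int[leb]_(t in \bigcup_n E n) (H' t)%:E)%E.
  congr (integral _ _ _); apply/seteqP; split; last first.
    by move=> t [n _]; exact: E_sub.
  move=> t /= /in01 /andP[t0 t1].
  pose r := Num.min t (1 - t).
  have r0 : 0 < r by rewrite lt_min t0 subr_gt0.
  have [n nr] : exists n : nat, r^-1 <= n%:R.
    by exists (Num.bound r^-1); rewrite ltW// archi_boundP// invr_ge0 ltW.
  have er : e n <= r.
    rewrite -[leRHS]invrK lef_pV2 ?posrE ?invr_gt0//.
    by rewrite (le_trans nr)// ler_nat !leqW.
  exists n => //; rewrite /E /= in_itv/=; move: er; rewrite le_min => /andP[-> H1] /=.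
  by lra.
have -> : (fun n => (H (1 - e n) - H (e n))%:E) =
    (fun n => \int[leb]_(t in E n) (H' t)%:E)%E.
  by apply/funext => n; rewrite FTC_H// ltrBlDr ltrDl.
apply: ge0_nondecreasing_set_cvg_integral.
- move=> n m nm; apply/subsetPset => t; rewrite /E /= !in_itv/= => /andP[].
  have enm : e m <= e n by rewrite lef_pV2 ?posrE// ler_nat.
  by move=> h1 h2; rewrite (le_trans enm)//= (le_trans h2)// lerD2l lerN2.
- by move=> n; exact: measurable_itv.
- by move=> n; apply/measurable_EFinP; apply: measurable_funS mH' => //.
- by move=> n t /E_sub/in01 t01; rewrite lee_fin H'_ge0.
Qed.

Let sigmaD1 t : 1 + sigma t = t^-1. Proof. by rewrite /sigma addrC subrK. Qed.

Let H_ge0 t : 0 < t < 1 -> 0 <= H t.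
Proof.
move=> t01; have /andP[t0 _] := t01; have p0 := pi_gt0 R.
have := entropy_lb mF iF F1 iF2 F2 (sigma_gt0 t01).
rewrite sigmaD1 ln_div ?posrE ?mulr_gt0// /H; lra.
Qed.

(** - ln (1 - t) <= 1 / (1 - t) - 1 <= 2 * t; the second inequality holds up to t = 1 / 2. *)
Let ln_onem_ge t : 0 < t <= 3^-1 -> - ln (1 - t) / 2 <= t.
Proof.
move=> /andP[t0 t3]; have t1 : 0 < 1 - t by lra.
have v0 : 0 < (1 - t)^-1 by rewrite invr_gt0.
have vt : (1 - t)^-1 <= 1 + 2 * t.
  by rewrite -[leLHS]mul1r ler_pdivrMr//; nra.
have : ln (1 - t)^-1 <= (1 - t)^-1 - 1.
  by rewrite -[X in ln X](subrK 1) addrC le_ln1Dx//; lra.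
rewrite lnV ?posrE//; lra.
Qed.

Let e_le3 n : 0 < e n <= 3^-1.
Proof. by rewrite e_gt0 lef_pV2 ?posrE// ler_nat. Qed.

(** As s * t = 1 - t, [entropy_ub] reads H t <= - ln (1 - t) / 2: given [F], the variable F_t is
    Gaussian of variance 1 - t. *)
Let H_left n : H (e n) <= e n.
Proof.
have /andP[e0 e3] := e_le3 n; have p0 := pi_gt0 R.
have e01 : 0 < e n < 1 by rewrite e0/=; lra.
have s0 := sigma_gt0 e01.
have := entropy_ub mF iF F1 iF2 F2 s0.
have sE : 1 - e n = sigma (e n) * e n.
  by rewrite /sigma mulrBl mulVf ?gt_eqF// mul1r.
have := ln_onem_ge (e_le3 n).
rewrite sE lnM ?posrE// [ln (2 * pi * sigma _)]lnM ?posrE ?mulr_gt0// /H; lra.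
Qed.

(** At t = 1 - 1 / (n + 3) the noise level s is 1 / (n + 2); the last summand tends to 0. *)
Let H_right n : H (1 - e n) = entropy P F n.+2%:R^-1 +
  (ln (2 * pi) / 2 + 2^-1) + - ln (1 - e n) / 2.
Proof.
rewrite /H; have -> : sigma (1 - e n) = n.+2%:R^-1.
  have y0 : 0 < n.+2%:R :> R by [].
  rewrite /sigma /e (_ : n.+3%:R = n.+2%:R + 1); last by rewrite natr1.
  move: (n.+2%:R : R) y0 => y y0; have y1 : 0 < y + 1 by rewrite addr_gt0.
  have -> : 1 - (y + 1)^-1 = y / (y + 1) by field; rewrite gt_eqF.
  by field; rewrite !gt_eqF.
by rewrite mulNr addrAC.
Qed.

Let cvg_e : e n @[n --> \oo] --> 0.
Proof.
have := @cvg_harmonic R; rewrite -(cvg_shiftn 2).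
by under eq_fun do rewrite /harmonic/= addn2.
Qed.

Let cvg_s : (n.+2%:R^-1 : R) @[n --> \oo] --> 0.
Proof.
have := @cvg_harmonic R; rewrite -(cvg_shiftn 1).
by under eq_fun do rewrite /harmonic/= addn1.
Qed.

Lemma de_bruijn_stein :
  (relative_entropy_normal f =
   (2^-1)%:E * \int[leb]_(t in `[0%R, 1%R]) K t)%E.
Proof.
rewrite integral_K; apply/eqP; rewrite eq_le; apply/andP; split.
- have X0 : (0 <= X)%E.
    by apply: integral_ge0 => t t01; rewrite lee_fin H'_ge0//; exact: in01.
  (* The two ends have independent indices: m goes to infinity first, where H (e m) <= e m, and
     leaves a bound on H (1 - e n) for each n. *)
  have bound n m : ((H (1 - e n) - H (e m))%:E <= X)%E.
    have e1 : 1 - e n < 1 by rewrite ltrBlDr ltrDl.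
    exact: H_increment_le (e_gt0 m) (e_lt m n) e1.
  case: X X0 bound => [x| |]//; last by move=> *; rewrite leey.
  move=> _ bound.
  have Hx n : H (1 - e n) <= x.
    have cx : x + e m @[m --> \oo] --> x.
      rewrite -[X in _ --> X]addr0; apply: cvgD; [exact: cvg_cst|exact: cvg_e].
    apply: (ler_cvg_to (cvg_cst (H (1 - e n))) cx); apply: nearW => m.
    by have := bound n m; have := H_left m; rewrite lee_fin; lra.
  apply: (relative_entropy_le Ff Z_normal FZ_indep iF F1 iF2 F2 _ cvg_s).
    by move=> n; rewrite invr_gt0.
  move=> n; have := Hx n; rewrite H_right.
  have /andP[e0 e3] := e_le3 n.
  have : ln (1 - e n) <= 0 by apply: ln_le0; lra.
  by lra.
(* Each increment converging to [X] is at most H (1 - e n), as H >= 0, hence at most D + e n. *)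
- have := relative_entropy_neqNy Ff.
  case relD : (relative_entropy_normal f) => [D| |]// _; last by rewrite leey.
  have cD : (D + e n)%:E @[n --> \oo] --> D%:E.
    apply: cvg_EFin; first exact: nearW.
    by rewrite -[X in _ --> X]addr0; apply: cvgD; [exact: cvg_cst|exact: cvg_e].
  rewrite -(cvg_lim _ cvg_X)// -(cvg_lim _ cD)//; apply: lee_lim.
  + by apply/cvg_ex; exists X; exact: cvg_X.
  + by apply/cvg_ex; exists D%:E.
  apply: nearW => n; rewrite lee_fin.
  have s0 : (0 : R) < n.+2%:R^-1 by rewrite invr_gt0.
  have := entropy_le_relative Ff iF F1 iF2 F2 s0 relD.
  have e01 : 0 < e n < 1 by have /andP[? ?] := e_le3 n; apply/andP; split; lra.
  have := H_ge0 e01; have := ln_onem_ge (e_le3 n); rewrite H_right; lra.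
Qed.

End de_bruijn.

Unset Implicit Arguments.

Theorem proposition1p4 (R : realType) (d : measure_display)
    (T : measurableType d) (P : probability T R)
    (F Z : {RV P >-> R}) (f tau : R -> R)
    (Ff : has_density F f)
    (F_mean : ('E_P[F] = 0)%E)
    (F_sqr : ('E_P[fun w => (F w ^+ 2)%R] = 1)%E)
    (F_tau : is_Stein_factor F tau)
    (Z_normal : is_normal Z 0 1)
    (FZ_indep : independent_RVs F Z) :
  (relative_entropy_normal f =
   (2^-1)%:E *
   \int[lebesgue_measure]_(t in `[0%R, 1%R])
     ((t / (1 - t))%R%:E *
      'E_P[fun w => (cond_expectation P (fun w' => Z w' * (1 - tau (F w')))
                       (interpolation F Z t) w ^+ 2)%R]))%E.
Proof.
have mF : measurable_fun setT (F : T -> R) by exact: measurable_funP.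
rewrite unlock in F_sqr; rewrite unlock in F_mean.
have iF2 : P.-integrable setT (fun w => (F w ^+ 2)%:E).
  apply/integrableP; split; first by apply/measurable_EFinP; exact: measurable_funX.
  under eq_integral => w _ do rewrite /= ger0_norm ?sqr_ge0//.
  by rewrite F_sqr ltry.
have i1 : P.-integrable setT (EFin \o (cst 1 : T -> R)).
  exact: finite_measure_integrable_cst.
(* From |F| <= 1 + F ^ 2. *)
have iF : P.-integrable setT (EFin \o (F : T -> R)).
  apply: le_integrable_f (integrable_fD i1 iF2) => // w.
  have := sqr_ge0 (`|F w| - 1); rewrite sqrrB1 real_normK ?num_real// => H.
  by have := normr_ge0 (F w); rewrite /=; lra.
apply: de_bruijn_stein => //.
- by rewrite /Rintegral F_mean.
- by rewrite /Rintegral F_sqr.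
Qed.
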